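(* Let $G$ be a directed graph on vertex set $[n]$ and write $$\omega B_G(\mathbf x;y+1,z+1)=\sum_{\alpha\vDash n}c^G_\alpha(y,z)\frac{\Psi_\alpha(\mathbf x)}{z_\alpha}.$$ Then $c^G_\alpha(y,z)\in\mathbb N[y,z]$ for all compositions $\alpha$.
   Context: For a coloring $\kappa:[n]\to\mathbb Z_{>0}$, $\mathrm{asc}(\kappa)$ is the number of directed edges $(i,j)$ of $G$ with $\kappa(i)<\kappa(j)$ and $\mathrm{inv}(\kappa)$ is the number of directed edges $(i,j)$ with $\kappa(i)>\kappa(j)$ (edges counted with multiplicity). The $B$-polynomial is $B_G(\mathbf x;y,z)=\sum_{\kappa:[n]\to\mathbb Z_{>0}}x_{\kappa(1)}\cdots x_{\kappa(n)}y^{\mathrm{asc}(\kappa)}z^{\mathrm{inv}(\kappa)}$. $\omega$ is the linear automorphism of quasisymmetric functions with $\omega(F_{n,S})=F_{n,[n-1]\setminus(n-S)}$, where $F_{n,S}=\sum_{j_1\le\dots\le j_n,\ j_i<j_{i+1}\ (i\in S)}x_{j_1}\cdots x_{j_n}$ and $n-S=\{n-s:s\in S\}$, extended coefficientwise in $y,z$. Here $z_\alpha=\prod_i i^{m_i}m_i!$ ($m_i$ the number of parts of $\alpha$ equal to $i$) is a constant, not the variable $z$. For compositions: $S_\alpha=\{\alpha_1,\dots,\alpha_1+\dots+\alpha_{\ell-1}\}$, blocks $B_i(\alpha)$ consecutive intervals of sizes $\alpha_i$, $\alpha\le\beta$ iff $S_\beta\subseteq S_\alpha$; $M_\alpha=\sum_{i_1<\dots<i_\ell}x_{i_1}^{\alpha_1}\cdots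 x_{i_\ell}^{\alpha_\ell}$; $\pi(\gamma)=\prod_i(\gamma_1+\dots+\gamma_i)$; $\pi(\alpha,\beta)=\prod_i\pi(\alpha^{(i)})$ with $\alpha^{(i)}$ the parts of $\alpha$ whose blocks lie in $B_i(\beta)$; $\Psi_\alpha=z_\alpha\sum_{\beta\ge\alpha}\pi(\alpha,\beta)^{-1}M_\beta$. *)

(* Defs.v *)
From HB Require Import structures.
From mathcomp Require Import all_boot all_order all_algebra.
Set Implicit Arguments. Unset Strict Implicit. Unset Printing Implicit Defensive.
Import Order.TTheory GRing.Theory Num.Theory.
Local Open Scope ring_scope.

Notation R := {poly {poly rat}}.
Definition yv : R := 'X.
Definition zv : R := ('X : {poly rat})%:P.

Fixpoint comps_aux (fuel m : nat) : seq (seq nat) :=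
  match fuel with
  | 0 => if m == 0 then [:: [::]] else [::]
  | f.+1 => if m == 0 then [:: [::]]
            else flatten [seq [seq k :: a | a <- comps_aux f (m - k)%N] | k <- iota 1 m]
  end.
Definition comps (n : nat) : seq (seq nat) := comps_aux n n.

Definition setS (a : seq nat) : seq nat :=
  [seq sumn (take k a) | k <- iota 1 (size a).-1].

Definition omegaS (n : nat) (S : seq nat) : seq nat :=
  [seq i <- iota 1 n.-1 | (n - i)%N \notin S].

Definition comp_le (a b : seq nat) : bool := all (fun s => s \in setS a) (setS b).

(* Quasisymmetric functions (of degree n) are represented as formal power series
   in x_1, x_2, ... by their coefficient function: a monomial
   x_1^{e_0} x_2^{e_1} ... x_N^{e_{N-1}} is encoded by the list e (trailing
   zeros are irrelevant).  Variable x_{k+1} corresponds to k : 'I_N. *)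

Definition content {n : nat} (e : seq nat) (f : {ffun 'I_n -> 'I_(size e)}) : bool :=
  [forall k : 'I_(size e), #|[set i | f i == k]| == nth 0%N e k].
Arguments content {n} e f.

(* directed graph on [n] as a list of directed edges (with multiplicity);
   vertex i+1 of the paper is i : 'I_n, colour j+1 is j. *)
Definition asc (n N : nat) (E : seq ('I_n * 'I_n)) (k : {ffun 'I_n -> 'I_N}) : nat :=
  count (fun p => (k p.1 < k p.2)%N) E.
Definition inv (n N : nat) (E : seq ('I_n * 'I_n)) (k : {ffun 'I_n -> 'I_N}) : nat :=
  count (fun p => (k p.2 < k p.1)%N) E.

Definition Bcoef (n : nat) (E : seq ('I_n * 'I_n)) (y z : R) (e : seq nat) : R :=
  \sum_(k : {ffun 'I_n -> 'I_(size e)} | content e k) y ^+ asc E k * z ^+ inv E k.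

Definition Fcoef (n : nat) (S : seq nat) (e : seq nat) : R :=
  (#|[set j : {ffun 'I_n -> 'I_(size e)} | content e j &&
      [forall a : 'I_n, forall b : 'I_n, (val b == (val a).+1) ==>
         ((j a <= j b)%N && ((val b \in S) ==> (j a < j b)%N))]]|)%:R.

Definition Mcoef (a : seq nat) (e : seq nat) : R :=
  (#|[set i : {ffun 'I_(size a) -> 'I_(size e)} |
      [forall p : 'I_(size a), forall q : 'I_(size a), (p < q)%N ==> (i p < i q)%N] &&
      [forall k : 'I_(size e), nth 0%N e k == (\sum_(j : 'I_(size a) | i j == k) nth 0%N a j)%N]]|)%:R.

Definition zcomp (a : seq nat) : nat :=
  (\prod_(i <- undup a) (i ^ count_mem i a * (count_mem i a)`!))%N.

Definition picomp (g : seq nat) : nat := (\prod_(i < size g) sumn (take i.+1 g))%N.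

(* alpha^{(i)}: parts of alpha whose blocks lie in B_i(beta) *)
Definition subcomp (a b : seq nat) (i : nat) : seq nat :=
  [seq nth 0%N a j | j <- iota 0 (size a) &
     (sumn (take i b) <= sumn (take j a))%N && (sumn (take j.+1 a) <= sumn (take i.+1 b))%N].

Definition pi2 (a b : seq nat) : nat := (\prod_(i < size b) picomp (subcomp a b i))%N.

Definition Psicoef (a : seq nat) (e : seq nat) : R :=
  (zcomp a)%:R * \sum_(b <- comps (sumn a) | comp_le a b) ((pi2 a b)%:R)^-1 * Mcoef b e.

Definition natpoly2 (p : R) : Prop := forall i j : nat, exists m : nat, (p`_i)`_j = m%:R.

(* Main.v *)
Require Import Defs.
From HB Require Import structures.
From mathcomp Require Import all_boot all_order all_algebra.
From mathcomp Require Import zify ring.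
Set Implicit Arguments. Unset Strict Implicit. Unset Printing Implicit Defensive.
Import GRing.Theory.
Local Open Scope ring_scope.

(* Choosing for every edge whether to delete it (weight 1), keep it (weight y) or reverse it
   (weight z) writes B_G(x; y+1, z+1) as a weighted sum of the generating functions of strict
   colourings of relations r on [n]; only acyclic r contribute.  Inclusion-exclusion over cut
   sets shows that omega sends the monomial coefficients f(h) to the alternating sum of f(h)
   over the refinements h of the reversed composition; for strict colourings of an acyclic r
   this sum counts the weak colourings, because block by block
   sum (-1)^(|A|-1) = 1 over the nonempty sets A of minimal elements.
   Weak colourings in turn are Psi-positive: a lower set X contains exactly |X| principal order
   ideals, counted with their generators, so removing such ideals one by one and dividing by the
   number of elements left each time recovers 1, and the product of these divisors is pi.  Hence
   c_alpha counts, with weights, the ways to peel off principal ideals of sizes alpha. *)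

(** * Compositions, partial sums and refinements *)

Lemma comps_auxS f m :
  comps_aux f.+1 m.+1 =
  flatten [seq [seq k :: a | a <- comps_aux f (m.+1 - k)] | k <- iota 1 m.+1].
Proof. by []. Qed.

Lemma comps_aux_fuel f m : (m <= f)%N -> comps_aux f m = comps m.
Proof.
rewrite /comps; elim/ltn_ind: f m => -[|f] IH [|m] // lem; rewrite !comps_auxS.
congr flatten; apply/eq_in_map => k; rewrite mem_iota => hk.
by congr map; rewrite IH ?(IH m) //; lia.
Qed.

Lemma compsS m :
  comps m.+1 =
  flatten [seq [seq k :: a | a <- comps (m.+1 - k)] | k <- iota 1 m.+1].
Proof.
rewrite {1}/comps comps_auxS; congr flatten; apply/eq_in_map => k; rewrite mem_iota => hk.
by rewrite comps_aux_fuel //; lia.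
Qed.

Lemma comps0 : comps 0 = [:: [::]]. Proof. by []. Qed.
Lemma comps1 : comps 1 = [:: [:: 1%N]]. Proof. by []. Qed.

Lemma mem_comps n a : (a \in comps n) = (sumn a == n) && all (ltn 0) a.
Proof.
elim/ltn_ind: n a => -[|n] IH a.
  by rewrite comps0 inE; case: a => // -[|k] a /=; rewrite ?andbF.
rewrite compsS; apply/flattenP/idP => [[s /mapP[k]]|].
  rewrite mem_iota => hk -> /mapP[b hb ->] /=; move: hb.
  by rewrite IH; [move=> /andP[/eqP hs ->]; rewrite andbT hs; apply/andP; split; lia | lia].
case: a => [//|k a]; rewrite [sumn _]/= [all _ _]/= => /and3P[/eqP hs hk ha].
exists [seq k :: b | b <- comps (n.+1 - k)].
  by apply: (map_f (fun k => [seq k :: b | b <- comps (n.+1 - k)])); rewrite mem_iota; lia.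
by apply/mapP; exists a => //; rewrite IH ?ha ?andbT; lia.
Qed.

Lemma comps_uniq n : uniq (comps n).
Proof.
elim/ltn_ind: n => -[|n] IH //; rewrite compsS.
have : uniq (iota 1 n.+1) by exact: iota_uniq.
have : all (fun k => 0 < k)%N (iota 1 n.+1).
  by apply/allP => k; rewrite mem_iota => /andP[].
elim: (iota 1 n.+1) => //= k s IHs /andP[k0 s0] /andP[ks us].
rewrite cat_uniq map_inj_uniq => [|a b [] //].
rewrite IH ?IHs ?andbT //=; last lia.
apply/hasPn => x /flattenP[t /mapP[j js ->]] /mapP[b _ ->].
by apply/mapP => -[c _ [jk _]]; rewrite -jk js in ks.
Qed.

Lemma big_comps_rev (V : nmodType) n (F : seq nat -> V) :
  \sum_(a <- comps n) F (rev a) = \sum_(a <- comps n) F a.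
Proof.
rewrite -(big_map rev predT F); apply: perm_big; apply: uniq_perm.
- by rewrite map_inj_uniq ?comps_uniq //; exact: (can_inj revK).
- exact: comps_uniq.
move=> a; apply/mapP/idP => [[b hb ->]|ha].
  by move: hb; rewrite !mem_comps sumn_rev all_rev.
by exists (rev a); rewrite ?revK // mem_comps sumn_rev all_rev -mem_comps.
Qed.

Definition incr_head (a : seq nat) : seq nat := (head 0 a).+1 :: behead a.

(** Position 1 is either a cut, and then the first part is 1, or not, and then the first part can be
    lowered by one. This recursion drives [sum_comps_sgn]. *)
Lemma big_comps_head (V : nmodType) n (F : seq nat -> V) :
  \sum_(a <- comps n.+2) F a =
  \sum_(a <- comps n.+1) (F (1%N :: a) + F (incr_head a)).
Proof.
have -> : \sum_(a <- comps n.+1) (F (1%N :: a) + F (incr_head a)) =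
  \sum_(a <- map (cons 1%N) (comps n.+1) ++ map incr_head (comps n.+1)) F a.
  by rewrite big_split [RHS]big_cat /= !big_map.
apply: perm_big; apply: uniq_perm; first exact: comps_uniq.
  rewrite cat_uniq !map_inj_in_uniq ?comps_uniq ?andbT /=.
  - apply/hasPn => x /mapP[a]; rewrite mem_comps => ha ->.
    apply/mapP => -[b _]; case: a ha => [|k a] //= /andP[_ /andP[k0 _]] [].
    by case: k k0.
  - move=> a b; rewrite !mem_comps.
    by case: a => [|k a] //; case: b => [|l b] // _ _ [-> ->].
  by move=> a b _ _ [].
move=> a; rewrite [RHS]mem_cat; apply/idP/orP.
  rewrite mem_comps; case: a => [|[|[|k]] a] //= /andP[/eqP hs ha] //.
  - left; apply/mapP; exists a => //.
    by rewrite mem_comps ha andbT; lia.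
  - right; apply/mapP; exists (k.+1 :: a) => //.
    by rewrite mem_comps /= ha andbT; lia.
case=> /mapP[b]; rewrite !mem_comps => /andP[/eqP hs hb] -> /=.
  by rewrite hb hs eqxx.
by case: b hs hb => [|k b] //= hs /andP[_ ->]; rewrite andbT; lia.
Qed.

(* Unlike [setS], the cuts include the trivial partial sums 0 and [sumn a]. *)
Fixpoint cut (a : seq nat) (i : nat) : bool :=
  if a is k :: a' then (i == 0)%N || ((k <= i)%N && cut a' (i - k)) else (i == 0)%N.

Lemma cut0 a : cut a 0 = true. Proof. by case: a. Qed.

Lemma cut_sumn a : cut a (sumn a).
Proof. by elim: a => //= k a IH; rewrite leq_addr addKn IH orbT. Qed.

Lemma cut_cat a b j : cut b j -> cut (a ++ b) (sumn a + j).
Proof.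
by move=> h; elim: a => //= k a IH; rewrite -addnA leq_addr addKn IH orbT.
Qed.

Lemma cut_catl a b j : (j <= sumn a)%N -> cut a j -> cut (a ++ b) j.
Proof.
elim: a j => [|k a IH] j /= hj; first by move=> /eqP ->; rewrite cut0.
case/orP => [->//|/andP[kj h]]; rewrite kj IH ?orbT //; lia.
Qed.

Lemma cut_catE a b j : all (ltn 0) a -> cut (a ++ b) (sumn a + j) = cut b j.
Proof.
elim: a => //= k a IH /andP[k0 ha].
rewrite -addnA leq_addr addKn IH //; have -> : (k + (sumn a + j) == 0)%N = false by lia.
by [].
Qed.

Lemma cut_split a i : cut a i -> exists a1 a2, a = a1 ++ a2 /\ sumn a1 = i.
Proof.
elim: a i => [|k a IH] i /=; first by move/eqP => ->; exists [::], [::].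
case/orP => [/eqP ->|/andP[ki /IH[a1 [a2 [-> h]]]]]; first by exists [::], (k :: a).
by exists (k :: a1), a2; split=> //=; lia.
Qed.

(** Reversal exchanges initial and final sums; one implication suffices because [rev] is an
    involution. *)
Lemma cut_rev a i : (i <= sumn a)%N -> cut (rev a) i = cut a (sumn a - i).
Proof.
have imp b j : cut b j -> cut (rev b) (sumn b - j).
  move=> /cut_split[b1 [b2 [-> <-]]]; rewrite rev_cat sumn_cat addKn.
  by apply: cut_catl; rewrite ?sumn_rev // -sumn_rev cut_sumn.
move=> hi; apply/idP/idP => /imp; rewrite ?sumn_rev ?revK ?subKn //.
Qed.

Lemma setSE a i : all (ltn 0) a -> (i \in setS a) = (0 < i < sumn a)%N && cut a i.
Proof.
elim: a i => [|k a IH] i; first by case: i.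
case: a IH => [|l a] IH /=; first by move=> _; rewrite in_nil; lia.
move=> /andP[k0 ha]; have := IH (i - k)%N ha; rewrite /setS /= => E.
rewrite in_cons addn0.
have -> : (i \in [seq sumn (take j [:: k, l & a]) | j <- iota 2 (size a)]) =
   (k <= i)%N && ((i - k)%N \in [seq sumn (take j (l :: a)) | j <- iota 1 (size a)]).
  apply/mapP/andP => [[j]|[ki /mapP[j]]].
    rewrite mem_iota => hj ->; case: j hj => [|j] //= hj; rewrite leq_addr; split=> //.
    by apply/mapP; exists j; rewrite ?mem_iota ?addKn //; lia.
  rewrite mem_iota => hj h; exists j.+1; first by rewrite mem_iota; lia.
  by rewrite /= -[sumn (take j _)]/(sumn (take j (l :: a))) -h subnKC.
rewrite E; case/andP: ha => l0 _; case: (ltngtP k i) => hk /=.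
- have -> : (i == 0)%N = false by lia.
  by have -> : (0 < i - k < l + sumn a)%N = (0 < i < k + (l + sumn a))%N by lia.
- by case: (posnP i) => [->|_]; rewrite ?andbF.
by rewrite -hk subnn eqxx orbT andbT; lia.
Qed.

(** The compositions below [g], built block by block so that [peel], [sgn] and [pi2] factor along
    the same recursion; [refinementsE] links them to [comp_le]. *)
Fixpoint refinements (g : seq nat) : seq (seq nat) :=
  if g is k :: g' then [seq a ++ b | a <- comps k, b <- refinements g'] else [:: [::]].

Lemma big_refinements (V : nmodType) k g (F : seq nat -> V) :
  \sum_(a <- refinements (k :: g)) F a =
  \sum_(a <- comps k) \sum_(b <- refinements g) F (a ++ b).
Proof. by rewrite /= big_allpairs_dep. Qed.

Lemma mem_refinements g a : all (ltn 0) g ->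
  reflect [/\ all (ltn 0) a, sumn a = sumn g & forall i, cut g i -> cut a i]
          (a \in refinements g).
Proof.
move=> hg; apply: (iffP idP).
  elim: g a hg => [|k g IH] a /=; first by rewrite inE => _ /eqP ->.
  move=> /andP[k0 hg] /allpairsP[[a1 a2] /= [h1 h2 ->]].
  move: h1; rewrite mem_comps => /andP[/eqP s1 p1].
  have [p2 s2 c2] := IH _ hg h2.
  rewrite all_cat p1 p2 sumn_cat s1 s2; split=> // i.
  case/orP => [/eqP ->|/andP[ki /c2 h]]; first by rewrite cut0.
  by have -> : i = (sumn a1 + (i - k))%N by [lia]; apply: cut_cat.
elim: g a hg => [|k g IH] a /=; first by case: a => // -[|k] a _ [].
move=> /andP[k0 hg] [pa sa ca].
have /cut_split[a1 [a2 [E s1]]] : cut a k by apply: ca; rewrite leqnn subnn cut0 orbT.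
move: pa; rewrite E all_cat => /andP[p1 p2].
apply/allpairsP; exists (a1, a2); split=> //=; first by rewrite mem_comps s1 eqxx.
apply: IH => //; split=> //; first by move: sa; rewrite E sumn_cat; lia.
move=> i ci; rewrite -(cut_catE a2 i p1) -E s1; apply: ca.
by rewrite leq_addr addKn ci orbT.
Qed.

Lemma refinements_uniq g : all (ltn 0) g -> uniq (refinements g).
Proof.
elim: g => //= k g IH /andP[k0 hg].
apply: allpairs_uniq; rewrite ?comps_uniq ?IH //.
move=> [a b] [c d] /allpairsP[[a' b'] /= [h1 h2 [-> ->]]].
move=> /allpairsP[[c' d'] /= [h3 h4 [-> ->]]] /=.
move: h1 h3; rewrite !mem_comps => /andP[/eqP s1 p1] /andP[/eqP s2 p2].
rewrite -s1 in s2; move: p1 p2 s2; clear.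
elim: a' c' => [|x a IH] [|y c] //=.
- by move=> _ _ _ ->.
- by move=> _ /andP[y0 _] h; lia.
- by move=> /andP[x0 _] _ h; lia.
move=> /andP[x0 pa] /andP[y0 pc] s [exy E]; rewrite exy in s *.
by have [-> ->] : (a, b') = (c, d') by apply: IH => //; lia.
Qed.

(** Indexing the positions 1 to n-1 by ['I_n.-1] turns indicators of the order into products over
    positions. *)
Lemma comp_leE n a b : a \in comps n -> b \in comps n ->
  comp_le a b = [forall i : 'I_n.-1, cut b i.+1 ==> cut a i.+1].
Proof.
rewrite !mem_comps => /andP[/eqP sa pa] /andP[/eqP sb pb].
apply/allP/forallP => [h i|h i]; last first.
  rewrite !setSE // sa sb => /andP[hi cb]; rewrite hi /=.
  have hi' : (i.-1 < n.-1)%N by lia.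
  by have /= := h (Ordinal hi'); rewrite prednK ?cb //; lia.
apply/implyP => cb; have := h i.+1; rewrite !setSE // sa sb cb.
have -> : (0 < i.+1 < n)%N by have := ltn_ord i; lia.
by apply.
Qed.

Lemma refinementsE n a b : a \in comps n -> b \in comps n ->
  (a \in refinements b) = comp_le a b.
Proof.
move=> ha hb; rewrite (comp_leE ha hb).
move: ha hb; rewrite !mem_comps => /andP[/eqP sa pa] /andP[/eqP sb pb].
apply/(mem_refinements _ pb)/forallP => [[_ _ h] i|h]; first exact/implyP/h.
split=> //; first by rewrite sa.
move=> [|i] ci; first by rewrite cut0.
have : (i.+1 <= sumn b)%N.
  by have [b1 [b2 [-> <-]]] := cut_split ci; rewrite sumn_cat leq_addr.
rewrite leq_eqVlt => /orP[/eqP ->|hi]; first by rewrite sb -sa cut_sumn.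
have hi' : (i < n.-1)%N by lia.
by have /implyP := h (Ordinal hi'); apply.
Qed.

Lemma refinements_comps n a b : b \in comps n -> a \in refinements b -> a \in comps n.
Proof.
rewrite !mem_comps => /andP[/eqP sb pb] /(mem_refinements _ pb)[pa sa _].
by rewrite pa sa sb eqxx.
Qed.

Lemma big_comp_le (V : nmodType) n b (F : seq nat -> V) : b \in comps n ->
  \sum_(a <- comps n | comp_le a b) F a = \sum_(a <- refinements b) F a.
Proof.
move=> hb; rewrite -big_filter; apply: perm_big; apply: uniq_perm.
- by rewrite filter_uniq ?comps_uniq.
- by apply: refinements_uniq; move: hb; rewrite mem_comps => /andP[].
move=> a; rewrite mem_filter; apply/andP/idP => [[le ha]|ha].
  by rewrite (refinementsE ha hb).
have ha' := refinements_comps hb ha.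
by rewrite -(refinementsE ha' hb).
Qed.

(** Every part of [g] is replaced by at least one part, and a single replacement is the part itself.
    Antisymmetry of the order and the triangularity behind uniqueness rest on this. *)
Lemma refinements_size g (a : seq nat) : all (ltn 0) g -> a \in refinements g ->
  (size g <= size a)%N /\ (size a = size g -> a = g).
Proof.
elim: g a => [|k g IH] a /=; first by rewrite inE => _ /eqP ->.
move=> /andP[k0 hg] /allpairsP[[a1 a2] /= [h1 h2 ->]].
have [le2 eq2] := IH _ hg h2; rewrite size_cat.
move: h1; rewrite mem_comps; case: a1 => [|x [|y a1]] //=.
- by case: k k0.
- rewrite addn0 => /andP[/eqP -> _]; split; first by rewrite add1n ltnS.
  by rewrite add1n => -[/eq2 ->].
move=> _; rewrite addSn ltnS (leq_trans le2) ?leq_addl //; split=> // -[].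
by move: le2; set s := size a2; set t := size g; lia.
Qed.

(** * Products of partial sums *)

Lemma picomp_gt0 a : all (ltn 0) a -> (0 < picomp a)%N.
Proof.
move=> pa; apply: prodn_cond_gt0 => i _.
case: a i pa => [|x a] [i hi] //= /andP[x0 _]; lia.
Qed.

(** The last factor is the total. A removal process meets the total first, hence the reversed
    compositions in the expansions into principal ideals. *)
Lemma picomp_rcons a k : picomp (rcons a k) = (picomp a * sumn (rcons a k))%N.
Proof.
rewrite /picomp size_rcons big_ord_recr /= take_oversize ?size_rcons //.
congr (_ * _)%N; apply: eq_bigr => i _.
by rewrite -cats1 takel_cat.
Qed.

Lemma sumn_take_lt a j : all (ltn 0) a -> (j < size a)%N -> (sumn (take j a) < sumn a)%N.
Proof.
move=> pa hj; rewrite -{2}(cat_take_drop j a) sumn_cat.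
move: pa; rewrite -{1}(cat_take_drop j a) all_cat => /andP[_].
case: (drop j a) (size_drop j a) => [|x s] /= h; first by lia.
by move=> /andP[x0 _]; lia.
Qed.

Lemma sumn_take_cat a b j : sumn (take (size a + j) (a ++ b)) = (sumn a + sumn (take j b))%N.
Proof. by rewrite take_cat ltnNge leq_addr /= addKn sumn_cat. Qed.

Lemma subcomp_cat0 k (a b g : seq nat) : a \in comps k -> all (ltn 0) b -> subcomp (a ++ b) (k :: g) 0 = a.
Proof.
rewrite mem_comps => /andP[/eqP sa pa] pb.
rewrite /subcomp size_cat iotaD filter_cat map_cat add0n /= take0 /= addn0.
have -> : [seq j <- iota 0 (size a) | (sumn (take j.+1 (a ++ b)) <= k)%N] = iota 0 (size a).
  apply/all_filterP/allP => j; rewrite mem_iota /= add0n => hj.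
  by rewrite takel_cat // -sa -{2}(cat_take_drop j.+1 a) sumn_cat leq_addr.
have -> : [seq j <- iota (size a) (size b) | (sumn (take j.+1 (a ++ b)) <= k)%N] = [::].
  apply/eqP; rewrite -(negbK (_ == _)) -has_filter; apply/hasPn => j.
  rewrite mem_iota => /andP[j1 j2]; rewrite -(subnKC j1) -addnS sumn_take_cat sa.
  (* The first part of [b] is positive, so every block of [b] ends beyond [k]. *)
  by case: b pb j2 => [|x b] /=; [rewrite addn0; lia | move=> /andP[x0 _] _; lia].
rewrite cats0 -[RHS](mkseq_nth 0%N) /mkseq; apply/eq_in_map => j.
by rewrite mem_iota nth_cat => /andP[_ ->].
Qed.

Lemma subcomp_catS k (a b g : seq nat) i : a \in comps k ->
  subcomp (a ++ b) (k :: g) i.+1 = subcomp b g i.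
Proof.
rewrite mem_comps => /andP[/eqP sa pa].
rewrite /subcomp size_cat iotaD filter_cat map_cat.
rewrite (_ : [seq j <- iota 0 (size a) | _] = [::]); last first.
  apply/eqP; rewrite -(negbK (_ == _)) -has_filter; apply/hasPn => j.
  rewrite mem_iota add0n => /= hj; rewrite takel_cat; last lia.
  by have := sumn_take_lt pa hj; rewrite negb_and sa; lia.
rewrite add0n -[in iota (size a) _](addn0 (size a)) iotaDl filter_map -map_comp /=.
rewrite (eq_filter (a2 := fun j =>
  (sumn (take i g) <= sumn (take j b))%N && (sumn (take j.+1 b) <= sumn (take i.+1 g))%N)).
  by apply/eq_map => j /=; rewrite nth_cat ltnNge leq_addr /= addKn.
move=> j; rewrite /= -addnS !sumn_take_cat sa !leq_add2l.
by case: g.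
Qed.

(** The parts of [a] are exactly those whose blocks lie in the first block of [k :: g]. *)
Lemma pi2_cat k (a b g : seq nat) : a \in comps k -> all (ltn 0) b ->
  pi2 (a ++ b) (k :: g) = (picomp a * pi2 b g)%N.
Proof.
move=> ha pb; rewrite /pi2 /= big_ord_recl subcomp_cat0 //; congr (_ * _)%N.
by apply: eq_bigr => i _; rewrite /= subcomp_catS.
Qed.

Lemma pi2_gt0 a g : all (ltn 0) g -> a \in refinements g -> (0 < pi2 a g)%N.
Proof.
elim: g a => [|k g IH] a /=; first by rewrite inE /pi2 big_ord0.
move=> /andP[k0 hg] /allpairsP[[a1 a2] /= [h1 h2 ->]].
have [p2 _ _] := mem_refinements _ hg h2.
rewrite pi2_cat // muln_gt0 IH // andbT picomp_gt0 //.
by move: h1; rewrite mem_comps => /andP[].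
Qed.

(** For a composition of n this is -1 to the number of positions in [n-1] that are not cuts; the
    product over parts makes it multiplicative under concatenation. *)
Definition sgn {K : pzRingType} (a : seq nat) : K := \prod_(k <- a) (-1) ^+ k.-1.

Lemma sgn_cat (K : pzRingType) a b : sgn (a ++ b) = sgn a * sgn b :> K.
Proof. exact: big_cat. Qed.

(** Compositions of n are subsets of n-1 positions, and each position outside the cut set carries a
    sign, so the sum factors. All inclusion-exclusion arguments below are instances. *)
Lemma sum_comps_sgn (K : comPzRingType) n (f h : nat -> K) :
  \sum_(a <- comps n) sgn a * \prod_(i < n.-1) (if cut a i.+1 then f i else h i) =
  \prod_(i < n.-1) (f i - h i).
Proof.
case: n => [|n] /=.
  by rewrite comps0 big_seq1 !big_ord0 /sgn big_nil mulr1.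
elim: n f h => [|n IH] f h.
  by rewrite comps1 big_seq1 !big_ord0 /sgn big_seq1 mulr1.
rewrite big_comps_head big_ord_recl -(IH (fun i => f i.+1) (fun i => h i.+1)).
rewrite big_distrr /= !big_seq; apply: eq_bigr => a; rewrite mem_comps => /andP[/eqP sa pa].
rewrite !big_ord_recl.
case: a sa pa => [|k a] //= sa /andP[k0 pa].
rewrite /sgn !big_cons /=; case: k sa k0 => // k sa _ /=.
rewrite exprS expr0 mul1r.
(* [P3] is the product over the positions after the first, where the two extensions of the
   composition have the same cuts. *)
set P3 := (X in _ = _ * (_ * X)).
rewrite [X in _ * (_ * X) + _](_ : _ = P3); last first.
  by apply: eq_bigr => i _; rewrite /bump /= !add1n subn1.
rewrite [X in _ + _ * (_ * X)](_ : _ = P3); last first.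
  by apply: eq_bigr => i _; rewrite /bump /= !add1n !ltnS subSS.
ring.
Qed.

(** * Removing blocks from a relation *)

(** Weighted count of the ways to remove sets of sizes [g] one after another. Strict colourings,
    weak colourings and sequences of principal ideals differ only in the kernel [w]. *)
Fixpoint peel (K : pzSemiRingType) (T : finType) (w : {set T} -> {set T} -> K)
    (g : seq nat) (f : {set T} -> K) (V : {set T}) : K :=
  if g is k :: g' then
    \sum_(A : {set T} | (A \subset V) && (#|A| == k)) w V A * peel w g' f (V :\: A)
  else f V.

Lemma peel_cat (K : pzSemiRingType) (T : finType) (w : {set T} -> {set T} -> K) a b f V :
  peel w (a ++ b) f V = peel w a (peel w b f) V.
Proof. by elim: a V => //= k a IH V; apply: eq_bigr => A _; rewrite IH. Qed.

Lemma eq_peel (K : pzSemiRingType) (T : finType) (w : {set T} -> {set T} -> K) a f g V :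
  f =1 g -> peel w a f V = peel w a g V.
Proof. by move=> E; elim: a V => //= k a IH V; apply: eq_bigr => A _; rewrite IH. Qed.

Lemma peel_sum (K : comPzSemiRingType) (T : finType) (w : {set T} -> {set T} -> K) a
    (I : Type) (s : seq I) (c : I -> K) (F : I -> {set T} -> K) V :
  peel w a (fun V => \sum_(i <- s) c i * F i V) V = \sum_(i <- s) c i * peel w a (F i) V.
Proof.
elim: a V => //= k a IH V.
under eq_bigr => A _ do rewrite IH big_distrr.
rewrite exchange_big; apply: eq_bigr => i _; rewrite big_distrr.
by apply: eq_bigr => A _; rewrite /= mulrCA.
Qed.

Definition nonzeros (e : seq nat) : seq nat := [seq k <- e | k != 0%N].

(** A zero entry removes the empty set at weight 1. This is the source of quasisymmetry. *)
Lemma peel_nonzeros (K : pzSemiRingType) (T : finType) (w : {set T} -> {set T} -> K) e f V :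
  (forall V, w V set0 = 1) -> peel w (nonzeros e) f V = peel w e f V.
Proof.
move=> w0; elim: e V => //= k e IH V; case: eqP => [->|_] /=; last first.
  by apply: eq_bigr => A _; rewrite IH.
rewrite (big_pred1 set0) ?w0 ?setD0 ?mul1r //= => A.
by rewrite /= cards_eq0 andbC; case: eqP => // ->; rewrite sub0set.
Qed.

Lemma sum_superset (V : nmodType) (T : finType) (B A : {set T}) m (F : {set T} -> V) :
  A \subset B ->
  \sum_(X : {set T} | (X \subset B :\: A) && (#|X| == m)) F (A :|: X) =
  \sum_(X : {set T} | [&& A \subset X, X \subset B & #|X| == #|A| + m]) F X.
Proof.
move=> AB; rewrite (reindex_onto (fun X => X :\: A) (fun X => A :|: X)) /=; last first.
  move=> X /andP[/subsetDP[_ dX] _]; rewrite setDUl setDv set0U.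
  by apply/setDidPl.
have E X : A :|: (X :\: A) = A :|: X.
  by apply/setP => x; rewrite !inE; case: (x \in A).
apply: eq_big => X; last by rewrite E => /andP[_ /eqP ->].
rewrite E -[_ == X](sameP setUidPr eqP) andbC; have [AX|//] := boolP (A \subset X).
rewrite /= cardsD (setIidPr AX) -(subnK (subset_leq_card AX)) addnK [(_ + #|A|)%N]addnC eqn_add2l.
congr (_ && _); apply/subsetDP/idP => [[XB _]|XB].
  by rewrite -(setID X A) (setIidPr AX) subUset AB.
by split; [exact: subset_trans (subsetDl _ _) XB | rewrite disjoint_sym disjoints_subset setCD subsetUr].
Qed.

(** * Lower sets and minimal elements *)

Definition lower (T : finType) (r : rel T) (V A : {set T}) : bool :=
  [forall u in V, forall v in A, r u v ==> (u \in A)].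

Definition minimals (T : finType) (r : rel T) (V A : {set T}) : bool :=
  [forall u in V, forall v in A, ~~ r u v].

Lemma lowerP (T : finType) (r : rel T) (V A : {set T}) :
  reflect (forall u v, u \in V -> v \in A -> r u v -> u \in A) (lower r V A).
Proof.
apply: (iffP forall_inP) => [h u v uV vA ruv|h u uV].
  by have /forall_inP/(_ v vA)/implyP := h u uV; apply.
by apply/forall_inP => v vA; apply/implyP; apply: h.
Qed.

Lemma minimalsP (T : finType) (r : rel T) (V A : {set T}) :
  reflect (forall u v, u \in V -> v \in A -> ~~ r u v) (minimals r V A).
Proof.
apply: (iffP forall_inP) => [h u v uV vA|h u uV].
  by have /forall_inP/(_ v vA) := h u uV.
by apply/forall_inP => v vA; apply: h.
Qed.

Lemma minimals_lower (T : finType) (r : rel T) (V A : {set T}) : minimals r V A -> lower r V A.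
Proof. by move=> /minimalsP h; apply/lowerP => u v uV vA; rewrite (negPf (h u v uV vA)). Qed.

Lemma lowerD (T : finType) (r : rel T) (V A X : {set T}) :
  lower r V A -> A \subset X -> X \subset V -> lower r (V :\: A) (X :\: A) = lower r V X.
Proof.
move=> /lowerP hA AX XV; apply/lowerP/lowerP => h u v uV vX ruv.
  case: (boolP (u \in A)) => [/(subsetP AX)//|uA].
  have vA : v \notin A by apply: contra uA => /hA; apply.
  by have := h u v; rewrite !inE uA vA uV vX => /(_ isT isT ruv).
move: uV vX; rewrite !inE => /andP[uA uV] /andP[vA vX]; rewrite uA /=; exact: h ruv.
Qed.

Lemma sum_card_iota (V : nmodType) (T : finType) (P : pred {set T}) m (G : {set T} -> V) :
  \sum_(j <- iota 1 m) \sum_(A : {set T} | P A && (#|A| == j)) G A =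
  \sum_(A : {set T} | P A && (0 < #|A| <= m)%N) G A.
Proof.
rewrite (exchange_big_dep (fun A => P A)) /=; last by move=> j A _ /andP[].
rewrite big_mkcondr; apply: eq_bigr => A PA; rewrite PA /=.
case: ifP => [h|h].
  rewrite big_mkcond (bigD1_seq #|A|) ?iota_uniq ?mem_iota //=.
  by rewrite eqxx big1 ?addr0 // => j; rewrite eq_sym => /negPf ->.
rewrite big1_seq // => j /andP[/eqP Aj]; rewrite mem_iota -Aj; lia.
Qed.

(** Common mechanism of the strict and the principal expansion. A lower set [X] is removed in steps,
    with a factor [u m j] for removing [j] of the [m] elements left; if the weights of the possible
    first steps always sum to 1, all ways of removing [X] together weigh 1. *)
Lemma peel_lower_block (K : comPzRingType) (T : finType) (r : rel T)
    (w : {set T} -> {set T} -> K) (c : seq nat -> K) (u : nat -> nat -> K) f k V :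
  (forall V A : {set T}, ~~ lower r V A -> w V A = 0) ->
  c [::] = 1 ->
  (forall j a, c (j :: a) = u (j + sumn a)%N j * c a) ->
  (forall V X : {set T}, X \subset V -> X != set0 -> lower r V X ->
     \sum_(A : {set T} | (A \subset X) && (A != set0)) u #|X| #|A| * w V A = 1) ->
  peel (fun V A => (lower r V A)%:R) [:: k] f V = \sum_(a <- comps k) c a * peel w a f V.
Proof.
move=> w0 c0 cS usum; elim/ltn_ind: k V => -[|k] IH V.
  rewrite comps0 big_seq1 c0 mul1r /= (big_pred1 set0) ?setD0.
    by rewrite (_ : lower _ _ _ = true) ?mul1r //; apply/lowerP => x y _; rewrite inE.
  by move=> A; rewrite /= cards_eq0 andbC; case: eqP => // ->; rewrite sub0set.
rewrite compsS big_flatten big_map.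
(* Fix the first removed set [A]. By induction the later steps recombine into a lower set of
   [V :\: A], and its union with [A] is a lower set [X] of [V]. *)
transitivity (\sum_(j <- iota 1 k.+1)
  \sum_(A : {set T} | (A \subset V) && (#|A| == j))
    u k.+1 #|A| * w V A *
    \sum_(X : {set T} | [&& A \subset X, X \subset V & #|X| == k.+1])
       (lower r V X)%:R * f (V :\: X)); last first.
  apply: eq_big_seq => j; rewrite mem_iota => hj.
  rewrite big_map; under [RHS]eq_bigr => a _ do rewrite /= big_distrr /=.
  rewrite exchange_big /=; apply: eq_bigr => A /andP[AV /eqP Aj].
  transitivity (\sum_(a <- comps (k.+1 - j)) u k.+1 #|A| * w V A * (c a * peel w a f (V :\: A))).
    rewrite -big_distrr /= -IH; last lia.
    have [hA|hA] := boolP (lower r V A); last by rewrite w0 // mulr0 !mul0r.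
    congr (_ * _); rewrite /=.
    have E : k.+1 = (#|A| + (k.+1 - j))%N by lia.
    rewrite [in LHS]E -(sum_superset _ _ AV).
    apply: eq_bigr => X /andP[/subsetDP[XV dX] _].
    rewrite -(lowerD hA (subsetUl A X)) ?subUset ?AV //.
    by rewrite setDUl setDv set0U (setDidPl dX) setDDl.
  apply: eq_big_seq => a; rewrite mem_comps cS => /andP[/eqP sa _].
  by rewrite sa subnKC ?Aj; [ring | lia].
rewrite sum_card_iota /=.
under [RHS]eq_bigr => A _ do rewrite big_distrr /=.
rewrite (exchange_big_dep (fun X : {set T} => (X \subset V) && (#|X| == k.+1))) /=; last first.
  by move=> A X _ /and3P[_ -> ->].
apply: eq_bigr => X /andP[XV /eqP cX].
have [hX|hX] := boolP (lower r V X); last first.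
  by rewrite mul0r big1 // => A _; rewrite mulr0.
(* For fixed [X], the first steps are its nonempty subsets, and their weights sum to 1. *)
rewrite mul1r -[LHS]mul1r -(usum V X XV) //; last by rewrite -cards_eq0 cX.
rewrite big_distrl cX /=; apply: eq_bigl => A.
rewrite XV eqxx andbT -cards_eq0 -lt0n; have [AX|] := boolP (A \subset X); last by rewrite andbF.
by rewrite (subset_trans AX XV) /= -cX (subset_leq_card AX) !andbT.
Qed.

Lemma sum_sign_subsets (K : comPzRingType) (T : finType) (M : {set T}) :
  M != set0 -> \sum_(A : {set T} | (A \subset M) && (A != set0)) (-1) ^+ #|A|.-1 = 1 :> K.
Proof.
case/set0Pn => p pM.
(* Expanding this product gives the signed sum over all subsets of [M]; it vanishes because of the
   factor at [p]. *)
have : \prod_(i : T) ((if i \in M then -1 else 0) + 1) = 0 :> K.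
  by rewrite (bigD1 p) //= pM addNr mul0r.
rewrite bigA_distr (bigD1 set0) //= big1 => [|i _]; last by rewrite inE.
rewrite (bigID (fun A : {set T} => A \subset M)) /= [X in _ + (_ + X)]big1 ?addr0; last first.
  move=> A /andP[_ /subsetPn[x xA xM]].
  by rewrite (bigD1 x) //= xA (negPf xM) mul0r.
move/eqP; rewrite addr_eq0 => /eqP E; rewrite [RHS]E -sumrN.
apply: eq_big => [A|A /andP[AM A0]]; first exact: andbC.
rewrite (bigID (mem A)) /= [X in _ * X]big1 => [|i /negPf -> //].
rewrite mulr1 (eq_bigr (fun=> -1)) => [|i iA]; last by rewrite iA (subsetP AM).
rewrite prodr_const; move: A0; rewrite -cards_eq0; case: #|A| => // m _ /=.
by rewrite exprS mulN1r opprK.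
Qed.

(** On a finite set, well-foundedness in this form is the absence of directed cycles, loops
    included. *)
Definition acyclic (T : finType) (r : rel T) : bool :=
  [forall V : {set T}, (V != set0) ==> [exists p in V, minimals r V [set p]]].

Lemma acyclicP (T : finType) (r : rel T) :
  reflect (forall V : {set T}, V != set0 -> exists2 p, p \in V & minimals r V [set p]) (acyclic r).
Proof.
apply: (iffP forallP) => [h V V0|h V].
  by have /implyP/(_ V0)/exists_inP[p] := h V; exists p.
by apply/implyP => /h[p pV hp]; apply/exists_inP; exists p.
Qed.

(** A nonempty set without minimal element loses no vertex in any step of nonzero weight, so the
    remainder is never empty. *)
Lemma peel_strict_cyclic (K : pzRingType) (T : finType) (r : rel T) g : ~~ acyclic r ->
  peel (fun V A => (minimals r V A)%:R) g (fun V => (V == set0)%:R) setT = 0 :> K.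
Proof.
rewrite negb_forall => /existsP[V0]; rewrite negb_imply => /andP[nV0 /exists_inPn hV0].
have : V0 \subset setT by exact: subsetT.
elim: g setT => [|k g IH] V V0V /=.
  by case: eqP => // V0'; move: V0V nV0; rewrite V0' subset0 => ->.
apply: big1 => A /andP[AV _]; have [/minimalsP hA|_] := boolP (minimals r V A); last by rewrite mul0r.
rewrite IH ?mulr0 //; apply/subsetP => p pV0; rewrite inE (subsetP V0V) // andbT.
apply/negP => pA; have /negP := hV0 p pV0; apply.
by apply/minimalsP => u v uV0; rewrite inE => /eqP ->; apply: hA => //; apply: (subsetP V0V).
Qed.

(** The first sets of nonzero weight inside a lower [X] are the nonempty subsets of its set [M] of
    minimal elements, and their signs sum to 1; acyclicity makes [M] nonempty. *)
Lemma peel_strict_block (K : comPzRingType) (T : finType) (r : rel T)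
    (f : {set T} -> K) k V : acyclic r ->
  peel (fun V A => (lower r V A)%:R) [:: k] f V =
  \sum_(a <- comps k) sgn a * peel (fun V A => (minimals r V A)%:R) a f V.
Proof.
move=> /acyclicP ac; apply: (peel_lower_block (u := fun _ j => (-1) ^+ j.-1)).
- move=> {}V A; have [/minimals_lower -> //|//] := boolP (minimals r V A).
- by rewrite /sgn big_nil.
- by move=> j a; rewrite /sgn big_cons.
move=> {}V X XV X0 /lowerP hX.
pose M := [set p in X | minimals r V [set p]].
rewrite -[RHS](@sum_sign_subsets K T M).
  rewrite [LHS](bigID (fun A : {set T} => A \subset M)) /= [X in _ + X]big1 ?addr0.
    apply: eq_big => [A|A /andP[_ AM]].
      rewrite andbAC; congr (_ && _); apply: andb_idl => AM.
      by apply: subset_trans AM _; apply/subsetP => p; rewrite inE => /andP[].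
    rewrite (_ : minimals _ _ _) ?mulr1 //; apply/minimalsP => x y xV /(subsetP AM).
    by rewrite inE => /andP[_ /minimalsP]; apply=> //; rewrite inE.
  move=> A /andP[/andP[AX _]] AM.
  case: (boolP (minimals r V A)) => [/minimalsP hA|]; last by rewrite mulr0.
  case/negP: AM; apply/subsetP => p pA; rewrite inE (subsetP AX) //.
  by apply/minimalsP => x y xV; rewrite inE => /eqP ->; apply: hA.
have [p pX /minimalsP hp] := ac X X0.
(* A predecessor of [p] in [V] would lie in [X], as [X] is lower, against minimality in [X]. *)
apply/set0Pn; exists p; rewrite inE pX; apply/minimalsP => x y xV.
rewrite inE => /eqP ->; apply/negP => rxp.
by have := hp x p (hX x p xV pX rxp); rewrite inE eqxx rxp => /(_ isT).
Qed.

Lemma peel_strict_weak (K : comPzRingType) (T : finType) (r : rel T)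
    (f : {set T} -> K) g V : acyclic r ->
  peel (fun V A => (lower r V A)%:R) g f V =
  \sum_(a <- refinements g) sgn a * peel (fun V A => (minimals r V A)%:R) a f V.
Proof.
move=> ac; elim: g V => [|k g IH] V.
  by rewrite /= big_seq1 /sgn big_nil mul1r.
rewrite -cat1s peel_cat peel_strict_block // big_refinements.
apply: eq_bigr => a _; rewrite (eq_peel _ _ _ IH) peel_sum big_distrr.
by apply: eq_bigr => b _; rewrite /= peel_cat sgn_cat mulrA.
Qed.

(** * Principal order ideals *)

Definition down (T : finType) (r : rel T) (V : {set T}) (p : T) : {set T} :=
  \bigcap_(X : {set T} | lower r V X && (p \in X)) X.

Lemma down_lower (T : finType) (r : rel T) (V : {set T}) p : lower r V (down r V p).
Proof.
apply/lowerP => u v uV /bigcapP vd ruv; apply/bigcapP => X hX.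
by have /andP[/lowerP h _] := hX; apply: h ruv => //; apply: vd.
Qed.

(** Defined as an intersection, [down] is the least lower set containing [p], without forming a
    transitive closure of [r]. *)
Lemma down_sub (T : finType) (r : rel T) (V X : {set T}) p :
  lower r V X -> (down r V p \subset X) = (p \in X).
Proof.
move=> hX; apply/idP/idP => [/subsetP h|pX].
  by apply: h; apply/bigcapP => Y /andP[].
by apply: bigcap_inf; rewrite hX.
Qed.

(** Counting generators makes the sum over the subsets of a lower set [X] of [V] equal to its
    size. *)
Definition principal (K : pzSemiRingType) (T : finType) (r : rel T) (V A : {set T}) : K :=
  #|[set p in V | down r V p == A]|%:R.

Lemma peel_principal_block (K : comUnitRingType) (T : finType) (r : rel T)
    (f : {set T} -> K) k V :
  (forall m, m.+1%:R \is a @GRing.unit K) ->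
  peel (fun V A => (lower r V A)%:R) [:: k] f V =
  \sum_(a <- comps k) (picomp a)%:R^-1 * peel (principal K r) (rev a) f V.
Proof.
move=> uK.
(* Reversal puts the part removed first at the head, where its factor is one over the total size. *)
rewrite -(big_comps_rev _ (fun a => (picomp a)%:R^-1 * peel (principal K r) (rev a) f V)).
under eq_bigr => a _ do rewrite revK.
pose c a := (picomp (rev a))%:R^-1 : K; rewrite -[RHS]/(\sum_(a <- comps k) c a * _).
apply: (peel_lower_block (u := fun m _ => m%:R^-1)).
- move=> {}V A hA; rewrite /principal (_ : [set _ in _ | _] = set0) ?cards0 //.
  apply/setP => p; rewrite !inE; apply/negP => /andP[_ /eqP E].
  by rewrite -E down_lower in hA.
- by rewrite /c /rev /= /picomp big_ord0 invr1.
- move=> j a; rewrite /c rev_cons picomp_rcons sumn_rcons sumn_rev natrM addnC.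
  (* The identity is required for arbitrary lists; when a factor vanishes, both sides are 0 by the
     convention that 0 inverts to 0. *)
  have [->|h1] := posnP (picomp (rev a)); first by rewrite mulr0n !mul0r invr0 mulr0.
  have [->|h2] := posnP (j + sumn a)%N; first by rewrite mulr0n !mulr0 invr0 mul0r.
  move: (picomp (rev a)) (j + sumn a)%N h1 h2 => [|x] [|y] // _ _.
  exact: invrM (uK x) (uK y).
move=> {}V X XV X0 hX.
rewrite -big_distrr /=.
suff -> : \sum_(A : {set T} | (A \subset X) && (A != set0)) principal K r V A = #|X|%:R.
  by rewrite mulVr //; move: X0; rewrite -cards_eq0; case: #|X|.
rewrite /principal -natr_sum; congr (_%:R).
under eq_bigr => A _ do rewrite -sum1dep_card.
(* Double counting: each [p] in [X] generates exactly one ideal, and it lies inside [X]. *)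
rewrite (exchange_big_dep (mem X)) /=.
  rewrite -sum1_card; apply: eq_bigr => p pX.
  rewrite (big_pred1 (down r V p)) // => A /=.
  rewrite (subsetP XV) //= [down r V p == A]eq_sym; have [->|] := eqVneq A (down r V p); last by rewrite andbF.
  rewrite andbT down_sub // pX /=; apply/set0Pn; exists p.
  by rewrite -(down_sub p (down_lower r V p)).
by move=> A p /andP[AX _] /andP[pV /eqP E]; rewrite -(down_sub p hX) E.
Qed.

(** The block expansion is applied to each part of [g]. The first part is removed last, so its
    expansion sits innermost, and [pi2] collects the products of the blocks. *)
Lemma peel_principal_weak (K : comUnitRingType) (T : finType) (r : rel T)
    (f : {set T} -> K) g V : all (ltn 0) g ->
  (forall m, m.+1%:R \is a @GRing.unit K) ->
  peel (fun V A => (lower r V A)%:R) (rev g) f V =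
  \sum_(a <- refinements g) (pi2 a g)%:R^-1 * peel (principal K r) (rev a) f V.
Proof.
move=> pg uK; elim: g f V pg => [|k g IH] f V.
  by rewrite big_seq1 /pi2 big_ord0 invr1 mul1r.
move=> /= /andP[k0 pg]; rewrite rev_cons -cats1 peel_cat IH //.
rewrite big_refinements exchange_big /= big_seq [RHS]big_seq; apply: eq_bigr => b hb.
rewrite (eq_peel _ _ _ (fun V => peel_principal_block r f k V uK)) peel_sum big_distrr.
rewrite big_seq [RHS]big_seq; apply: eq_bigr => a ha.
have [pb _ _] := mem_refinements _ pg hb.
rewrite /= rev_cat peel_cat pi2_cat // natrM mulrA; congr (_ * _).
have := picomp_gt0; move: ha; rewrite mem_comps => /andP[_ pa] /(_ _ pa).
have := pi2_gt0 pg hb.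
case: (pi2 b g) => // x _; case: (picomp a) => // y _.
by rewrite (invrM (uK y) (uK x)).
Qed.

(** * Colourings and the bases F and M *)

(** Two relations let one count serve both the chains behind [Fcoef] and the strict colourings
    behind [Bcoef]. *)
Definition compatible (T : finType) (weak strict : rel T) N (V : {set T})
    (k : {ffun T -> 'I_N}) : bool :=
  [forall u in V, forall v in V,
    (weak u v ==> (k u <= k v)%N) && (strict u v ==> (k u < k v)%N)].

Lemma compatibleP (T : finType) (weak strict : rel T) N (V : {set T}) (k : {ffun T -> 'I_N}) :
  reflect (forall u v, u \in V -> v \in V ->
             (weak u v -> (k u <= k v)%N) /\ (strict u v -> (k u < k v)%N))
          (compatible weak strict V k).
Proof.
apply: (iffP forall_inP) => [h u v uV vV|h u uV].
  have /forall_inP/(_ v vV)/andP[/implyP h1 /implyP h2] := h u uV; by split.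
apply/forall_inP => v vV; have [h1 h2] := h u v uV vV.
by apply/andP; split; apply/implyP.
Qed.

(* Colourings of [V] with colours at least [m], where [e] counts the colours [m], [m+1], ...;
   the vertices outside [V] get the dummy colour 0. *)
Definition partial_colouring (T : finType) (weak strict : rel T) p m (e : seq nat)
    (V : {set T}) (k : {ffun T -> 'I_p.+1}) : bool :=
  [&& [forall u, (u \notin V) ==> (k u == ord0)],
      [forall u in V, (m <= k u)%N],
      [forall c : 'I_p.+1, (m <= c)%N ==> (#|[set u in V | k u == c]| == nth 0%N e (c - m))] &
      compatible weak strict V k].

Lemma partial_colouringP (T : finType) (weak strict : rel T) p m e
    (V : {set T}) (k : {ffun T -> 'I_p.+1}) :
  reflect [/\ forall u, u \notin V -> k u = ord0,
      forall u, u \in V -> (m <= k u)%N,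
      forall c : 'I_p.+1, (m <= c)%N -> #|[set u in V | k u == c]| = nth 0%N e (c - m) &
      compatible weak strict V k] (partial_colouring weak strict m e V k).
Proof.
apply: (iffP and4P) => -[h1 h2 h3 h4]; split=> //.
- by move=> u uV; apply/eqP; have /forallP/(_ u)/implyP := h1; apply.
- by move=> u uV; have /forall_inP := h2; apply.
- by move=> c mc; apply/eqP; have /forallP/(_ c)/implyP := h3; apply.
- by apply/forallP => u; apply/implyP => uV; rewrite h1.
- by apply/forall_inP.
- by apply/forallP => c; apply/implyP => mc; rewrite h3.
Qed.

(** The class of the least colour [m] must be lower for [weak] and consist of minimal elements for
    [strict]; then the rest is coloured freely from [m.+1] on, which is one step of [peel]. *)
Lemma card_partial_colouring (K : pzSemiRingType) (T : finType) (weak strict : rel T)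
    p m e (V : {set T}) : (m + size e = p.+1)%N ->
  #|[set k | partial_colouring (p := p) weak strict m e V k]|%:R =
  peel (fun V A => (lower weak V A && minimals strict V A)%:R) e
       (fun V => (V == set0)%:R) V :> K.
Proof.
elim: e m V => [|x e IH] m V /= sz.
  congr (_%:R); have [->|V0] := eqVneq V set0.
    apply/eqP/cards1P; exists [ffun => ord0]; apply/setP => k; rewrite !inE.
    apply/partial_colouringP/eqP => [[h _ _ _]|->].
      by apply/ffunP => u; rewrite ffunE h ?inE.
    split=> [u _|u|c|]; rewrite ?ffunE ?inE //; first by have := ltn_ord c; lia.
    by apply/compatibleP => u v; rewrite inE.
  apply/eqP; rewrite cards_eq0; apply/eqP/setP => k; rewrite !inE.
  apply/negP => /partial_colouringP[_ h _ _].
  have /set0Pn[u uV] := V0; have := leq_ltn_trans (h u uV) (ltn_ord (k u)); lia.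
have mp : (m < p.+1)%N by lia.
pose c := Ordinal mp.
rewrite -sum1_card natr_sum (partition_big
  (fun k : {ffun T -> 'I_p.+1} => [set u in V | k u == c])
  (fun A => (A \subset V) && (#|A| == x))) /=; last first.
  move=> k; rewrite inE => /partial_colouringP[_ _ h _].
  rewrite (h c) /= ?subnn // eqxx andbT.
  by apply/subsetP => u; rewrite inE => /andP[].
apply: eq_bigr => A /andP[AV /eqP cA].
have [/andP[/lowerP lA /minimalsP mA]|hA] := boolP (lower _ _ _ && _); last first.
  rewrite mul0r big1 // => k; rewrite inE => /andP[/partial_colouringP[_ h2 _ /compatibleP h4] /eqP E].
  case/negP: hA; rewrite -E; apply/andP; split.
    apply/lowerP => u v uV; rewrite !inE => /andP[vV /eqP kv] uv; rewrite uV.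
    have [h _] := h4 u v uV vV; have := h uv; have := h2 u uV; rewrite kv /=.
    by move=> a b; apply/eqP/val_inj/eqP; rewrite /= eqn_leq a b.
  apply/minimalsP => u v uV; rewrite !inE => /andP[vV /eqP kv]; apply/negP => uv.
  have [_ h] := h4 u v uV vV; have := h uv; have := h2 u uV; rewrite kv /=; lia.
rewrite mul1r -(IH m.+1); last by lia.
rewrite -sum1_card natr_sum.
(* [h] paints [A] with the least colour and [h'] resets it to the dummy colour; they match
   colourings of [V :\: A] with those of [V] whose least class is [A]. *)
pose h (k : {ffun T -> 'I_p.+1}) := [ffun u => if u \in A then c else k u].
pose h' (k : {ffun T -> 'I_p.+1}) := [ffun u => if u \in A then ord0 else k u].
rewrite (reindex_onto h h'); last first.
  move=> k /andP[_ /eqP E]; apply/ffunP => u; rewrite !ffunE.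
  by have [|//] := boolP (u \in A); rewrite -{1}E inE => /andP[_ /eqP ->].
apply: eq_bigl => k; rewrite !inE.
apply/andP/idP => [[/andP[/partial_colouringP[h1 h2 h3 h4] /eqP E] /eqP hk]|].
  have kA u : u \in A -> k u = ord0 by move=> uA; rewrite -hk ffunE uA.
  have kh u : u \notin A -> k u = h k u by move=> uA; rewrite ffunE (negPf uA).
  apply/partial_colouringP; split.
  - move=> u; rewrite inE negb_and negbK; case: (boolP (u \in A)) => [/kA //|uA /= uV].
    by rewrite kh // h1.
  - move=> u; rewrite inE => /andP[uA uV]; rewrite kh // ltn_neqAle h2 // andbT.
    move: uA; rewrite -E inE uV /=; apply: contra => /eqP mk; exact/eqP/val_inj.
  - move=> d md; rewrite (_ : nth _ _ _ = nth 0%N (x :: e) (d - m)); last first.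
      by rewrite -[(d - m)%N]prednK ?subn_gt0 //= subnS.
    rewrite -h3; last exact: ltnW.
    apply: eq_card => u; rewrite !inE; case: (boolP (u \in A)) => uA /=; last by rewrite kh.
    rewrite ffunE uA; have [cd|] := eqVneq c d; last by rewrite andbF.
    by move: md; rewrite -cd /= ltnn.
  apply/compatibleP => u v; rewrite !inE => /andP[uA uV] /andP[vA vV].
  rewrite !kh //; exact: (compatibleP _ _ _ _ h4).
move=> /partial_colouringP[h1 h2 h3 /compatibleP h4].
have hc u : u \in V -> (h k u == c) = (u \in A).
  move=> uV; rewrite ffunE; have [|uA] := boolP (u \in A); first by rewrite eqxx.
  apply/negP => /eqP kc; have := h2 u; rewrite inE uA uV kc /= => /(_ isT); lia.
have EA : [set u in V | h k u == c] = A.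
  apply/setP => u; rewrite inE; have [uV|uV] := boolP (u \in V); first by rewrite hc.
  by apply/esym/negP => /(subsetP AV); apply/negP.
split; last first.
  apply/eqP/ffunP => u; rewrite !ffunE; have [uA|//] := boolP (u \in A).
  by rewrite h1 // inE uA.
rewrite EA eqxx andbT; apply/partial_colouringP; split.
- move=> u uV; rewrite ffunE ifF ?h1 ?inE ?(negPf uV) ?andbF //.
  by apply/negP => /(subsetP AV); apply/negP.
- move=> u uV; rewrite ffunE; case: (boolP (u \in A)) => // uA.
  by apply: ltnW; apply: h2; rewrite inE uA.
- move=> d; rewrite leq_eqVlt => /orP[/eqP md|md].
    have -> : d = c by apply: val_inj.
    by rewrite EA subnn.
  rewrite (_ : nth 0%N (x :: e) _ = nth 0%N e (d - m.+1)); last first.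
    by rewrite -[(d - m)%N]prednK ?subn_gt0 //= subnS.
  rewrite -h3 //; apply: eq_card => u; rewrite !inE ffunE.
  case: (boolP (u \in A)) => //= uA.
  by have [cd|] := eqVneq c d; [move: md; rewrite -cd /= ltnn | rewrite andbF].
apply/compatibleP => u v uV vV; rewrite !ffunE.
case: (boolP (u \in A)) => uA; case: (boolP (v \in A)) => vA.
- by split=> // uv; have := mA u v uV vA; rewrite uv.
- have := h2 v; rewrite inE vA vV => /(_ isT) /= mv; split=> _ //; exact: ltnW.
- split=> uv; first by rewrite (lA u v) in uA.
  by have := mA u v uV vA; rewrite uv.
by apply: h4; rewrite inE ?uA ?vA.
Qed.

Lemma card_colouring (K : pzSemiRingType) (T : finType) (weak strict : rel T) e :
  #|[set k : {ffun T -> 'I_(size e)} |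
      [forall c : 'I_(size e), #|[set u | k u == c]| == nth 0%N e c] &&
      compatible weak strict setT k]|%:R =
  peel (fun V A => (lower weak V A && minimals strict V A)%:R) e
       (fun V => (V == set0)%:R) setT :> K.
Proof.
(* The dummy colour needs a nonempty colour set, so the empty list is treated apart. *)
case: e => [|x e] /=.
  congr (_%:R); have [E|] := eqVneq [set: T] set0.
    have T0 (u : T) : False by have := in_setT u; rewrite E inE.
    apply/eqP/cards1P; exists [ffun u => False_rect 'I_0 (T0 u)].
    apply/setP => k; rewrite !inE; apply/andP/eqP => [_|->].
      by apply/ffunP => u; case: (T0 u).
    split; first by apply/forallP => -[].
    by apply/compatibleP => u; case: (T0 u).
  case/set0Pn => u _; apply/eqP; rewrite cards_eq0; apply/eqP/setP => k.
  by case: (k u).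
rewrite -[RHS](@card_partial_colouring _ _ weak strict (size e) 0 (x :: e)) //.
congr (_%:R); apply: eq_card => k; rewrite !inE.
apply/andP/partial_colouringP => [[/forallP h hk]|[_ _ h hk]]; split=> //.
- by move=> u; rewrite inE.
- by move=> c _; rewrite subn0 -(eqP (h c)); apply: eq_card => u; rewrite !inE.
apply/forallP => c; apply/eqP; rewrite -[RHS](congr1 _ (subn0 c)) -h //.
by apply: eq_card => u; rewrite !inE.
Qed.

(** * Deleting, keeping or reversing edges *)

Definition no_rel {T : Type} : rel T := fun _ _ => false.

Definition strict_kernel (K : pzSemiRingType) (T : finType) (r : rel T) (V A : {set T}) : K :=
  (minimals r V A)%:R.

Definition base (K : pzSemiRingType) (T : finType) (V : {set T}) : K := (V == set0)%:R.

Fixpoint orientations (K : pzSemiRingType) (T : Type) (y z : K) (E : seq (T * T)) :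
    seq (K * seq (T * T)) :=
  if E is p :: E' then
    flatten [seq [:: (o.1, o.2); (y * o.1, p :: o.2); (z * o.1, (p.2, p.1) :: o.2)]
            | o <- orientations y z E']
  else [:: (1, [::])].

(** Edge by edge: an ascent survives deleted or kept, giving 1 + y; a descent survives deleted or
    reversed, giving 1 + z; an edge with equal colours survives only deleted. *)
Lemma sum_orientations (K : comPzSemiRingType) n N (y z : K) (E : seq ('I_n * 'I_n))
    (k : {ffun 'I_n -> 'I_N}) :
  (y + 1) ^+ asc E k * (z + 1) ^+ Defs.inv E k =
  \sum_(o <- orientations y z E) o.1 * (all (fun p => k p.1 < k p.2)%N o.2)%:R.
Proof.
elim: E => [|p E IH] /=; first by rewrite big_seq1 /= !mul1r.
rewrite big_flatten big_map; rewrite /asc /Defs.inv /= -/(asc E k) -/(Defs.inv E k) !exprD mulrACA IH.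
rewrite big_distrr; apply: eq_bigr => o _; rewrite !big_cons big_nil addr0 /=.
case: (ltngtP (k p.1) (k p.2)) => _ /=; rewrite ?expr1 ?expr0 ?mul1r ?mulr1 ?mulr0 ?addr0 ?add0r //.
  by rewrite mulrDl mul1r mulrA addrC.
by rewrite mulrDl mul1r mulrA addrC.
Qed.

Definition edge_rel (T : eqType) (s : seq (T * T)) : rel T := fun u v => (u, v) \in s.

Lemma Bcoef_peel n (E : seq ('I_n * 'I_n)) (y z : R) e :
  Bcoef E (y + 1) (z + 1) e =
  \sum_(o <- orientations y z E)
    o.1 * peel (strict_kernel R (edge_rel o.2)) e (@base R _) setT.
Proof.
rewrite /Bcoef; under eq_bigr => k _ do rewrite sum_orientations.
rewrite exchange_big /=; apply: eq_bigr => o _.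
rewrite -big_distrr /=; congr (_ * _).
transitivity (#|[set k : {ffun 'I_n -> 'I_(size e)} |
      [forall c : 'I_(size e), #|[set u | k u == c]| == nth 0%N e c] &&
      compatible no_rel (edge_rel o.2) setT k]|%:R : R).
  rewrite -sum1_card natr_sum.
  under [LHS]eq_bigr => k _ do rewrite mulrb.
  rewrite -big_mkcondr.
  apply: eq_bigl => k; rewrite inE; congr (_ && _).
  apply/allP/compatibleP => [h u v _ _|h [u v] uv].
    by split=> // uv; apply: (h (u, v)).
  by have [_] := h u v (in_setT _) (in_setT _); apply.
rewrite card_colouring; elim: e setT => //= x e IH V.
apply: eq_bigr => A _; rewrite IH; congr (_%:R * _).
by rewrite (_ : lower _ _ _ = true) //; apply/lowerP.
Qed.

(** * Monomial coefficients of F and M *)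

Lemma card_ord_interval n a b : (b <= n)%N -> #|[set u : 'I_n | (a <= u < b)%N]| = (b - a)%N.
Proof.
elim: b => [|b IH] bn.
  by rewrite sub0n; apply: eq_card0 => u; rewrite inE ltn0 andbF.
have [ab|ba] := leqP a b; last first.
  have -> : (b.+1 - a = 0)%N by lia.
  apply: eq_card0 => u; rewrite inE; apply/negP => /andP[au ub].
  have := leq_ltn_trans au ub; lia.
rewrite subSn // -IH ?(ltnW bn) //.
rewrite (_ : [set _ | _] = Ordinal bn |: [set u : 'I_n | (a <= u < b)%N]).
  by rewrite cardsU1 inE /= ltnn andbF.
by apply/setP => u; rewrite !inE -val_eqE /= ltnS [(u <= b)%N]leq_eqVlt; case: eqP => //= ->; rewrite ab.
Qed.

Definition next_rel n : rel 'I_n := fun u v => val v == (val u).+1.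
Definition descent_rel n (S : seq nat) : rel 'I_n :=
  fun u v => next_rel u v && (val v \in S).

Lemma lower_next n m (A : {set 'I_n}) : (m <= n)%N ->
  A \subset [set u : 'I_n | (m <= u)%N] ->
  lower (@next_rel n) [set u : 'I_n | (m <= u)%N] A -> A = [set u : 'I_n | (m <= u < m + #|A|)%N].
Proof.
move=> mn AV /lowerP hA.
have dn j (u v : 'I_n) : v = (u + j)%N :> nat -> v \in A -> (m <= u)%N -> u \in A.
  elim: j u => [|j IH] u; first by rewrite addn0 => /val_inj ->.
  move=> E vA mu; have un : (u.+1 < n)%N by have := ltn_ord v; lia.
  apply: (hA u (Ordinal un)); rewrite ?inE ?/next_rel //=.
  by apply: IH => //=; lia.
have AS : A \subset [set u : 'I_n | (m <= u < m + #|A|)%N].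
  apply/subsetP => v vA; have := subsetP AV v vA; rewrite !inE => mv; rewrite mv /=.
  have := card_ord_interval m (ltn_ord v); rewrite subSn // => cI.
  have : [set u : 'I_n | (m <= u < v.+1)%N] \subset A.
    apply/subsetP => u; rewrite inE => /andP[mu uv].
    by apply: (dn (v - u)%N u v) => //; lia.
  by move=> /subset_leq_card; rewrite cI => h; rewrite -(subnKC mv) -addnS leq_add2l.
apply/eqP; rewrite eqEcard AS /=.
have [h|h] := leqP (m + #|A|) n; first by rewrite card_ord_interval // addKn.
have := subset_leq_card AV.
rewrite (_ : [set u : 'I_n | (m <= u)%N] = [set u : 'I_n | (m <= u < n)%N]); last first.
  by apply/setP => u; rewrite !inE ltn_ord andbT.
rewrite card_ord_interval //; lia.
Qed.

(** On a chain the only lower set of given size is an initial interval, so at most one sequence of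
    removals remains; it is admissible iff [S] meets the chain only at block boundaries. *)
Lemma peel_chain (K : pzSemiRingType) n (S e : seq nat) m : (m <= n)%N ->
  peel (fun V A => (lower (@next_rel n) V A && minimals (@descent_rel n S) V A)%:R) e
    (fun V => (V == set0)%:R) [set u : 'I_n | (m <= u)%N] =
  ((m + sumn e == n)%N && all (fun s => (m < s < n)%N ==> cut e (s - m)) S)%:R :> K.
Proof.
elim: e m => [|k e IH] m mn.
  rewrite [sumn _]/= addn0 /=; congr (_%:R); congr nat_of_bool.
  have [->|ne] := eqVneq m n.
    rewrite (_ : all _ _ = true); last by apply/allP => s _; apply/implyP; lia.
    by apply/eqP/setP => u; rewrite !inE leqNgt ltn_ord.
  have h : (m < n)%N by rewrite ltn_neqAle ne.
  by apply/negP => /eqP/setP/(_ (Ordinal h)); rewrite !inE leqnn.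
rewrite /=.
have [h|h] := leqP (m + k) n; last first.
  rewrite big1 => [|A /andP[AV /eqP cA]].
    by rewrite (_ : _ == n = false) //; lia.
  have := subset_leq_card AV.
  rewrite (_ : [set u : 'I_n | _] = [set u : 'I_n | (m <= u < n)%N]); last first.
    by apply/setP => u; rewrite !inE ltn_ord andbT.
  by rewrite card_ord_interval // cA => kn; exfalso; lia.
pose B := [set u : 'I_n | (m <= u < m + k)%N].
have cB : #|B| = k by rewrite card_ord_interval // addKn.
rewrite (bigD1 B) /=; last first.
  by rewrite cB eqxx andbT; apply/subsetP => u; rewrite !inE => /andP[].
rewrite big1 ?addr0; last first.
  move=> A /andP[/andP[AV /eqP cA] /eqP AB].
  rewrite (_ : lower _ _ _ = false) ?mul0r //; apply/negP => /(lower_next mn AV).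
  by rewrite cA.
rewrite (_ : _ :\: B = [set u : 'I_n | (m + k <= u)%N]); last first.
  by apply/setP => u; rewrite !inE; lia.
rewrite IH // (_ : lower _ _ _ = true); last first.
  by apply/lowerP => u v; rewrite !inE /next_rel /= => mu /andP[_ vk] /eqP vu; lia.
(* The value [s = m] is harmless because its predecessor is already gone, and [s = m + k] opens the
   next block. *)
rewrite (_ : minimals _ _ _ = all (fun s => ~~ (m < s < m + k)%N) S); last first.
  apply/minimalsP/allP => [hB s sS|hS u v].
    apply/negP => hs.
    have vn : (s < n)%N by lia.
    have un : (s.-1 < n)%N by lia.
    have := hB (Ordinal un) (Ordinal vn); rewrite !inE /descent_rel /next_rel /= sS andbT.
    by rewrite prednK ?eqxx; lia.
  rewrite !inE => mu vB; apply/negP => /andP[/eqP vu vS].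
  by have := hS _ vS; case/andP: vB => _ ->; rewrite vu ltnS mu.
rewrite -natrM mulnb addnA; congr (_%:R); congr nat_of_bool.
rewrite /= andbCA; have [E|//] := eqVneq (m + k + sumn e)%N n.
rewrite /= -all_predI; apply: eq_all => s /=.
rewrite subnDA.
have [sm|ms] := leqP s m.
  by have -> : (m + k < s)%N = false by lia.
have -> : (s - m == 0)%N = false by lia.
rewrite /=; case: (ltngtP s (m + k)) => hs.
- have -> : (s < n)%N by lia.
  by have -> : (k <= s - m)%N = false by lia.
- by have -> : (k <= s - m)%N by lia.
by rewrite hs addKn leqnn subnn cut0 /= implybT.
Qed.

Lemma FcoefE n S e :
  Fcoef n S e = ((sumn e == n) && all (fun s => (0 < s < n)%N ==> cut e s) S)%:R.
Proof.
transitivity (#|[set k : {ffun 'I_n -> 'I_(size e)} |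
      [forall c : 'I_(size e), #|[set u | k u == c]| == nth 0%N e c] &&
      compatible (@next_rel n) (@descent_rel n S) setT k]|%:R : R).
  congr (_%:R); apply: eq_card => k; rewrite !inE; congr (_ && _).
  apply/forallP/compatibleP => [h u v _ _|h u].
    have /forallP/(_ v)/implyP := h u; rewrite /descent_rel /next_rel => hv; split.
      by move=> /hv /andP[].
    by move=> /andP[/hv /andP[_ /implyP]].
  apply/forallP => v; apply/implyP => uv.
  have [h1 h2] := h u v (in_setT _) (in_setT _).
  by rewrite h1 //=; apply/implyP => vS; apply: h2; rewrite /descent_rel /next_rel uv.
rewrite card_colouring (_ : setT = [set u : 'I_n | (0 <= u)%N]).
  rewrite peel_chain // add0n; congr (_ && _)%:R.
  by apply: eq_all => s; rewrite subn0.
by apply/setP => u; rewrite !inE.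
Qed.

(** An increasing index map with positive exponents must list the support of [e] in order, so it is
    unique if it exists. *)
Lemma McoefE b e : all (ltn 0) b -> Mcoef b e = (b == nonzeros e)%:R.
Proof.
move=> pb; rewrite /Mcoef.
set P := [set i | _]; pose s := [seq k <- iota 0 (size e) | nth 0%N e k != 0%N].
have Es : nonzeros e = map (nth 0%N e) s.
  by rewrite /nonzeros -{1}[e](mkseq_nth 0%N) /mkseq filter_map.
pose L (i : {ffun 'I_(size b) -> 'I_(size e)}) := [seq val (i j) | j <- enum 'I_(size b)].
have nthL i (j : 'I_(size b)) : nth 0%N (L i) j = i j.
  by rewrite (nth_map j) ?size_enum_ord // nth_ord_enum.
have b_pos (j : 'I_(size b)) : (0 < nth 0%N b j)%N by apply: (allP pb); apply: mem_nth.
have inP i : i \in P -> b = nonzeros e /\ L i = s.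
  rewrite inE => /andP[/forallP hi /forallP he].
  have mono (j l : 'I_(size b)) : (j < l)%N -> (i j < i l)%N.
    by have /forallP/(_ l)/implyP := hi j; apply.
  have inj j l : i j = i l -> j = l.
    move=> E; apply: val_inj; case: (ltngtP j l) => // /mono; by rewrite E ltnn.
  have eL : L i = s.
    (* Both lists are strictly increasing, so equal membership suffices. *)
    apply: (irr_sorted_eq ltn_trans ltnn).
    - apply: (homo_sorted (e := fun j l : 'I_(size b) => (j < l)%N)); first exact: mono.
      by have := iota_ltn_sorted 0 (size b); rewrite -val_enum_ord sorted_map.
    - by apply: sorted_filter (iota_ltn_sorted _ _); apply: ltn_trans.
    move=> k; rewrite mem_filter mem_iota /= add0n; apply/mapP/andP => [[j _ ->]|[k0 kN]].
      split; last exact: ltn_ord.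
      by rewrite (eqP (he (i j))) (bigD1 j) //=; have := b_pos j; lia.
    move: k0; rewrite (eqP (he (Ordinal kN))) => k0.
    have [j /eqP ij] : exists j, i j == Ordinal kN.
      apply/existsP; apply: contraR k0; rewrite negb_exists => /forallP h.
      by rewrite big1 // => j hj; have := h j; rewrite hj.
    by exists j; rewrite ?mem_enum // ij.
  split=> //; rewrite Es -eL -map_comp -[LHS](mkseq_nth 0%N) /mkseq -val_enum_ord -map_comp.
  apply: eq_map => j /=; rewrite (eqP (he (i j))) (bigD1 j) //= big1 ?addn0 // => l.
  by move=> /andP[/eqP /inj ->]; rewrite eqxx.
congr (_%:R); case: eqP => [E|nE]; last first.
  by apply/eqP; rewrite cards_eq0; apply/eqP/setP => i; rewrite in_set0; apply/negP => /inP[].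
have szs : size s = size b by rewrite E Es size_map.
have sN j : (j < size b)%N -> (nth 0%N s j < size e)%N.
  move=> hj; have : nth 0%N s j \in s by rewrite mem_nth // szs.
  by rewrite mem_filter mem_iota => /andP[_ /andP[]].
apply/eqP/cards1P; exists [ffun j : 'I_(size b) => Ordinal (sN j (ltn_ord j))].
apply/setP => i; rewrite in_set1; apply/idP/eqP => [/inP[_ eL]|->].
  by apply/ffunP => j; apply: val_inj; rewrite ffunE /= -nthL eL.
have us : uniq s by rewrite filter_uniq ?iota_uniq.
rewrite inE; apply/andP; split.
  apply/forallP => j; apply/forallP => l; apply/implyP => jl; rewrite !ffunE /=.
  apply: (sorted_ltn_nth ltn_trans) => //; rewrite ?inE ?szs //.
  by apply: sorted_filter (iota_ltn_sorted _ _); apply: ltn_trans.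
have bE (j : 'I_(size b)) : nth 0%N b j = nth 0%N e (nth 0%N s j).
  by rewrite {1}E Es (nth_map 0%N) ?szs.
apply/forallP => k; have [ks|ks] := boolP (val k \in s).
  have kb : (index (val k) s < size b)%N by rewrite -szs index_mem.
  rewrite (bigD1 (Ordinal kb)) /=; last by rewrite ffunE; apply/eqP/val_inj; rewrite /= nth_index.
  rewrite (bE (Ordinal kb)) /= nth_index // big1 ?addn0 // => l /andP[/eqP lk].
  rewrite -val_eqE /= => /eqP nl; case: nl.
  by rewrite -lk ffunE /= index_uniq ?szs.
rewrite big1 => [|j /eqP jk].
  by move: ks; rewrite mem_filter mem_iota ltn_ord /= andbT negbK.
by case/negP: ks; rewrite -jk ffunE /= mem_nth ?szs.
Qed.

(** * The action of omega and the Psi-expansion *)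

Lemma cut_nonzeros e i : cut (nonzeros e) i = cut e i.
Proof.
elim: e i => //= k e IH i; case: eqP => [->|_] /=; rewrite IH ?subn0 //=.
by case: eqP => // ->; rewrite cut0.
Qed.

Lemma sumn_nonzeros e : sumn (nonzeros e) = sumn e.
Proof. by elim: e => //= k e IH; case: eqP => [->|_] /=; rewrite IH. Qed.

Lemma nonzeros_gt0 e : all (ltn 0) (nonzeros e).
Proof. by apply/allP => k; rewrite mem_filter => /andP[]; case: k. Qed.

Lemma nonzeros_comps n e : (nonzeros e \in comps n) = (sumn e == n).
Proof. by rewrite mem_comps sumn_nonzeros nonzeros_gt0 andbT. Qed.

Lemma nonzeros_id n g : g \in comps n -> nonzeros g = g.
Proof.
rewrite mem_comps => /andP[_ /allP pg].
by apply/all_filterP/allP => k /pg; case: k.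
Qed.

Lemma peel_base_sumn (K : pzSemiRingType) (T : finType) (w : {set T} -> {set T} -> K) e (V : {set T}) :
  sumn e != #|V| -> peel w e (@base K T) V = 0.
Proof.
elim: e V => [|k e IH] V /=.
  by rewrite /base eq_sym cards_eq0 => /negPf ->.
move=> h; apply: big1 => A /andP[AV /eqP cA]; rewrite IH ?mulr0 //.
by apply: contra h => /eqP ->; rewrite cardsD (setIidPr AV) cA subnKC // -cA subset_leq_card.
Qed.

Lemma Bcoef_nonzeros n (E : seq ('I_n * 'I_n)) (y z : R) e :
  Bcoef E (y + 1) (z + 1) e =
  if nonzeros e \in comps n then Bcoef E (y + 1) (z + 1) (nonzeros e) else 0.
Proof.
rewrite !Bcoef_peel nonzeros_comps; case: eqP => [_|/eqP h].
  apply: eq_bigr => o _; rewrite peel_nonzeros // => V.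
  by rewrite /strict_kernel (_ : minimals _ _ _) //; apply/minimalsP => u v _; rewrite inE.
by apply: big1 => o _; rewrite peel_base_sumn ?mulr0 // cardsT card_ord.
Qed.

Lemma comp_le_anti n a b : a \in comps n -> b \in comps n ->
  comp_le a b -> comp_le b a -> a = b.
Proof.
move=> ha hb; rewrite -(refinementsE ha hb) -(refinementsE hb ha).
move: ha hb; rewrite !mem_comps => /andP[_ pa] /andP[_ pb].
move=> /(refinements_size pb)[le1 eq1] /(refinements_size pa)[le2 _].
by apply: eq1; apply/eqP; rewrite eqn_leq le1 le2.
Qed.

Lemma comp_le_refl n a : a \in comps n -> comp_le a a.
Proof. by move=> ha; rewrite (comp_leE ha ha); apply/forallP => i; apply/implyP. Qed.

Lemma natr_forall (K : pzSemiRingType) m (P : pred 'I_m) :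
  [forall i, P i]%:R = \prod_(i < m) (P i)%:R :> K.
Proof.
case: forallP => [h|/forallP]; first by rewrite big1 // => i _; rewrite h.
rewrite negb_forall => /existsP[i /negPf Pi].
elim: m P i Pi => [|m IH] P i Pi; first by case: i {Pi}.
rewrite big_ord_recl; have [j E|E] := unliftP ord0 i.
  by rewrite -(IH (fun i => P (lift ord0 i)) j) ?mulr0 // -E.
by rewrite -E Pi mul0r.
Qed.

(** This is the expansion of F as the sum of M over all refinements. *)
Lemma Fcoef_setS n a e : a \in comps n ->
  Fcoef n (setS a) e = ((nonzeros e \in comps n) && comp_le (nonzeros e) a)%:R.
Proof.
move=> ha; rewrite FcoefE nonzeros_comps; congr (_%:R); congr nat_of_bool.
have [E|//] := eqVneq (sumn e) n; rewrite /=; apply: eq_in_all => s.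
move: ha; rewrite mem_comps => /andP[/eqP sa pa].
rewrite setSE // sa => /andP[hs _]; rewrite hs /=.
by rewrite setSE ?nonzeros_gt0 // sumn_nonzeros E hs cut_nonzeros.
Qed.

(** Position i is required to be a cut of [e] exactly when n-i is not a cut of [a]; reversing the
    exponents aligns the two positions. *)
Lemma Fcoef_omegaS n a e : a \in comps n ->
  Fcoef n (omegaS n (setS a)) e =
  ((nonzeros e \in comps n) &&
   [forall i : 'I_n.-1, cut a i.+1 || cut (rev (nonzeros e)) i.+1])%:R.
Proof.
move=> ha; rewrite FcoefE nonzeros_comps; congr (_%:R); congr nat_of_bool.
have [E|//] := eqVneq (sumn e) n; rewrite /=.
move: ha; rewrite mem_comps => /andP[/eqP sa pa].
have cutE i : (i < n.-1)%N -> cut (rev (nonzeros e)) i.+1 = cut e (n - i.+1).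
  by move=> hi; rewrite cut_rev sumn_nonzeros E ?cut_nonzeros //; lia.
apply/allP/forallP => [h i|h s].
  rewrite cutE //; have hi := ltn_ord i; case: (boolP (cut a i.+1)) => //= ci.
  have := h (n - i.+1)%N; rewrite mem_filter mem_iota setSE // sa subKn; last lia.
  rewrite (negPf ci) andbF /=.
  have -> : (1 <= n - i.+1 < 1 + n.-1)%N by lia.
  by have -> : (0 < n - i.+1 < n)%N by [lia]; apply.
rewrite mem_filter mem_iota setSE // sa => /andP[hs hi]; apply/implyP => _.
have hi' : (n - s.+1 < n.-1)%N by lia.
have := h (Ordinal hi'); rewrite cutE //=.
have -> : (n - s.+1).+1 = (n - s)%N by lia.
rewrite subKn; last lia.
case/orP => // ca; move: hs; rewrite ca andbT; lia.
Qed.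

Lemma forall_andb (T : finType) (P Q : pred T) :
  [forall x, P x] && [forall x, Q x] = [forall x, P x && Q x].
Proof.
apply/andP/forallP => [[/forallP hP /forallP hQ] x|h]; first by rewrite hP hQ.
by split; apply/forallP => x; have /andP[] := h x.
Qed.

Lemma sgn_sqr (K : comPzRingType) a : sgn a * sgn a = 1 :> K.
Proof.
rewrite /sgn -big_split big1 // => k _.
by rewrite /= -exprD addnn -mul2n exprM sqrrN !expr1n.
Qed.

Lemma natr_unit m : m.+1%:R \is a @GRing.unit R.
Proof.
rewrite -(rmorph_nat (@polyC {poly rat})) rmorph_unit //.
rewrite -(rmorph_nat (@polyC rat)) rmorph_unit //.
by rewrite unitfE Num.Theory.pnatr_eq0.
Qed.

Lemma zcomp_gt0 a : all (ltn 0) a -> (0 < zcomp a)%N.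
Proof.
move=> pa; rewrite /zcomp big_seq prodn_cond_gt0 // => i.
by rewrite mem_undup => /(allP pa) /= i0; rewrite muln_gt0 fact_gt0 expn_gt0 i0.
Qed.

(** Only the M indexed by the nonzero exponents sees this monomial, and [zcomp] cancels. *)
Lemma sum_Psicoef n (c : seq nat -> R) e :
  \sum_(a <- comps n) c a * Psicoef a e / (zcomp a)%:R =
  if nonzeros e \in comps n then
    \sum_(a <- refinements (nonzeros e)) (pi2 a (nonzeros e))%:R^-1 * c a
  else 0.
Proof.
have PsiE a : a \in comps n -> c a * Psicoef a e / (zcomp a)%:R =
    if (nonzeros e \in comps n) && comp_le a (nonzeros e)
    then (pi2 a (nonzeros e))%:R^-1 * c a else 0.
  move=> ha; have := ha; rewrite mem_comps => /andP[/eqP sa pa].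
  have zu : (zcomp a)%:R \is a @GRing.unit R.
    by have := zcomp_gt0 pa; case: (zcomp a) => // x _; apply: natr_unit.
  rewrite /Psicoef sa mulrCA mulrC mulKr // mulrC.
  have -> : \sum_(b <- comps n | comp_le a b) (pi2 a b)%:R^-1 * Mcoef b e =
     \sum_(b <- comps n) (if b == nonzeros e then
        (if comp_le a b then (pi2 a b)%:R^-1 else 0) else 0) :> R.
    rewrite big_mkcond; apply: eq_big_seq => b; rewrite mem_comps => /andP[_ pb].
    by rewrite McoefE //; case: (b == _); case: comp_le; rewrite ?mulr1 ?mulr0.
  have [hg|hg] /= := boolP (nonzeros e \in comps n).
    rewrite (bigD1_seq (nonzeros e)) ?comps_uniq //= eqxx big1 ?addr0.
      by case: comp_le; rewrite ?mul0r.
    by move=> b /negPf ->.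
  rewrite big1_seq ?mul0r // => b /andP[_ hb]; case: eqP => // bE.
  by rewrite -bE hb in hg.
rewrite (eq_big_seq _ PsiE); case: ifP => hg /=; last by rewrite big1.
by rewrite -big_mkcond (big_comp_le _ hg).
Qed.

(** Möbius orthogonality in the Boolean lattice of cut sets. *)
Lemma sum_comps_interval (K : comPzRingType) n g e : g \in comps n -> e \in comps n ->
  \sum_(a <- comps n) sgn a * (comp_le e a && comp_le a g)%:R =
  (if g == e then sgn e else 0) :> K.
Proof.
move=> hg he; case: eqP => [->|ne].
  rewrite (bigD1_seq e) ?comps_uniq //= (comp_le_refl he) mulr1 big_seq_cond big1 ?addr0 //.
  move=> a /andP[ha /eqP ae]; case: andP => [[h1 h2]|_]; last by rewrite mulr0.
  by case: ae; apply: (comp_le_anti ha he h2 h1).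
transitivity (\sum_(a <- comps n) sgn a * \prod_(i < n.-1)
   (if cut a i.+1 then (cut e i.+1)%:R else (~~ cut g i.+1)%:R) : K).
  apply: eq_big_seq => a ha; congr (_ * _).
  rewrite (comp_leE he ha) (comp_leE ha hg) forall_andb natr_forall.
  by apply: eq_bigr => i _; case: (cut a _); rewrite ?implybT ?andbT // implybF.
rewrite (sum_comps_sgn _ (fun i => (cut e i.+1)%:R) (fun i => (~~ cut g i.+1)%:R)).
(* At a position where exactly one of [e] and [g] has a cut, the factor is 1-1 or 0-0. *)
have [i /negPf ni] : exists i : 'I_n.-1, cut e i.+1 != cut g i.+1.
  apply/existsP; apply: contraT; rewrite negb_exists => /forallP h; case: ne.
  have h' (i : 'I_n.-1) : cut e i.+1 = cut g i.+1 by move: (h i); rewrite negbK => /eqP.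
  by apply: (comp_le_anti hg he); rewrite (@comp_leE n) //;
    apply/forallP => i; rewrite h' implybb.
rewrite (bigD1 i) //=; move: ni.
by case: (cut e _); case: (cut g _) => //= _; rewrite subrr mul0r.
Qed.

Lemma quasisymmetric_F_expansion n (f : seq nat -> R) :
  (forall e, f e = if nonzeros e \in comps n then f (nonzeros e) else 0) ->
  exists d : seq nat -> R, forall e, f e = \sum_(a <- comps n) d a * Fcoef n (setS a) e.
Proof.
(* The witness is the Möbius inverse of the expansion of F into M. *)
move=> hf; exists (fun a => sgn a * \sum_(g <- comps n | comp_le a g) sgn g * f g) => e.
rewrite hf; case: ifP => he; last first.
  by rewrite big1_seq // => a /andP[_ ha]; rewrite Fcoef_setS // he mulr0.
transitivity (\sum_(g <- comps n) sgn g * f g *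
    \sum_(a <- comps n) sgn a * (comp_le (nonzeros e) a && comp_le a g)%:R).
  rewrite (bigD1_seq (nonzeros e)) ?comps_uniq //= sum_comps_interval // eqxx big_seq_cond.
  rewrite big1 ?addr0 => [|g /andP[hg /negPf ge]]; last by rewrite sum_comps_interval // ge mulr0.
  by rewrite mulrAC sgn_sqr mul1r.
under eq_bigr => g _ do rewrite big_distrr /=.
rewrite exchange_big /=; apply: eq_big_seq => a ha; rewrite Fcoef_setS // he /=.
rewrite big_distrr big_distrl /= [RHS]big_mkcond; apply: eq_bigr => g _.
by case: (comp_le _ a); case: (comp_le a g) => /=; ring.
Qed.

(** The effect of omega in terms of the coefficients of [f] alone, whichever F-expansion [d] is
    used. *)
Lemma omega_coef n (d : seq nat -> R) (f : seq nat -> R) e :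
  (forall e, f e = \sum_(a <- comps n) d a * Fcoef n (setS a) e) ->
  \sum_(a <- comps n) d a * Fcoef n (omegaS n (setS a)) e =
  if nonzeros e \in comps n then
    \sum_(h <- refinements (rev (nonzeros e))) sgn h * f h
  else 0.
Proof.
move=> hf; case: ifP => he; last first.
  by rewrite big1_seq // => a /andP[_ ha]; rewrite Fcoef_omegaS // he mulr0.
have hr : rev (nonzeros e) \in comps n.
  by move: he; rewrite !mem_comps sumn_rev all_rev.
rewrite -(big_comp_le _ hr).
transitivity (\sum_(a <- comps n) d a * \sum_(h <- comps n) sgn h *
    (comp_le h (rev (nonzeros e)) && comp_le h a)%:R).
  apply: eq_big_seq => a ha; congr (_ * _); rewrite Fcoef_omegaS // he /= natr_forall.
  (* Each position contributes 1 minus the indicator that neither composition cuts there; expanding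
     the product sums over the common refinements [h]. *)
  transitivity (\sum_(h <- comps n) sgn h * \prod_(i < n.-1) (if cut h i.+1 then 1
     else (~~ cut (rev (nonzeros e)) i.+1 && ~~ cut a i.+1)%:R) : R).
    rewrite (sum_comps_sgn _ (fun=> 1)
      (fun i => (~~ cut (rev (nonzeros e)) i.+1 && ~~ cut a i.+1)%:R)).
    apply: eq_bigr => i _; case: (cut a _); case: (cut (rev _) _) => /=;
      by rewrite ?subr0 ?subrr.
  apply: eq_big_seq => h hh; congr (_ * _).
  rewrite (comp_leE hh hr) (comp_leE hh ha) forall_andb natr_forall.
  by apply: eq_bigr => i _; case: (cut h _); rewrite ?implybT // !implybF.
under eq_bigr => a _ do rewrite big_distrr /=.
rewrite exchange_big /= [RHS]big_mkcond; apply: eq_big_seq => h hh.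
case: (comp_le h (rev _)) => /=; last by rewrite big1 // => a _; rewrite !mulr0.
rewrite hf big_distrr; apply: eq_big_seq => a ha /=.
by rewrite Fcoef_setS // (nonzeros_id hh) hh /= mulrCA.
Qed.

(** The explicit value of the coefficients c, manifestly with nonnegative integer coefficients. *)
Definition omegaB_coef n (E : seq ('I_n * 'I_n)) (a : seq nat) : R :=
  \sum_(o <- orientations yv zv E | acyclic (edge_rel o.2))
    o.1 * peel (principal R (edge_rel o.2)) (rev a) (@base R _) setT.

(** For each acyclic orientation both sides compute the same removal of lower sets of sizes [rev g]:
    the left by strict steps, the right by principal ideals. Cyclic ones contribute 0. *)
Lemma sum_sgn_Bcoef n (E : seq ('I_n * 'I_n)) g : g \in comps n ->
  \sum_(h <- refinements (rev g)) sgn h * Bcoef E (yv + 1) (zv + 1) h =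
  \sum_(a <- refinements g) (pi2 a g)%:R^-1 * omegaB_coef E a.
Proof.
rewrite mem_comps => /andP[_ pg].
under eq_bigr => h _ do rewrite Bcoef_peel big_distrr /=.
rewrite exchange_big /=.
under [RHS]eq_bigr => a _ do rewrite big_distrr /=.
rewrite [RHS]exchange_big /= [RHS]big_mkcond; apply: eq_bigr => o _.
under eq_bigr => h _ do rewrite mulrCA.
rewrite -big_distrr /=; case: ifP => [ac|/negbT cy]; last first.
  by rewrite big1 ?mulr0 // => h _; rewrite peel_strict_cyclic ?mulr0.
rewrite -(peel_strict_weak _ _ _ ac) (peel_principal_weak _ _ _ pg natr_unit) big_distrr.
by apply: eq_bigr => a _; rewrite /= mulrCA.
Qed.

Lemma pi2_unit n a g : g \in comps n -> a \in refinements g -> (pi2 a g)%:R \is a @GRing.unit R.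
Proof.
rewrite mem_comps => /andP[_ pg] /(pi2_gt0 pg).
by case: (pi2 a g) => // m _; apply: natr_unit.
Qed.

(** The system is triangular: the term at [g] has an invertible factor, and all other refinements
    have more parts. Hence the induction on [n - size g]. *)
Lemma sum_refinements_inj n (c c' : seq nat -> R) :
  (forall g, g \in comps n ->
     \sum_(a <- refinements g) (pi2 a g)%:R^-1 * c a =
     \sum_(a <- refinements g) (pi2 a g)%:R^-1 * c' a) ->
  {in comps n, c =1 c'}.
Proof.
move=> eqc g; have [k] := ubnP (n - size g); elim: k g => // k IH g lek hg.
have hg' := hg; move: hg'; rewrite mem_comps => /andP[/eqP sg pg].
have gg : g \in refinements g by rewrite (refinementsE hg hg) (comp_le_refl hg).
have := eqc g hg; rewrite !(bigD1_seq g) ?refinements_uniq //=.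
rewrite [X in _ + X](_ : _ =
  \sum_(a <- refinements g | a != g) (pi2 a g)%:R^-1 * c' a); last first.
  rewrite big_seq_cond [RHS]big_seq_cond; apply: eq_bigr => a /andP[ra ag].
  have ha := refinements_comps hg ra; congr (_ * _); apply: IH => //.
  have [le eqs] := refinements_size pg ra.
  have lts : (size g < size a)%N.
    by rewrite ltn_neqAle le andbT; apply: contra ag => /eqP /esym /eqs /eqP.
  have szn : (size a <= n)%N.
    move: ha; rewrite mem_comps => /andP[/eqP <- pa].
    elim: (a) pa => //= x s IHs /andP[x0 ps]; rewrite -add1n leq_add // IHs //.
  apply: (@leq_trans (n - size g)); last by rewrite -ltnS.
  by apply: ltn_sub2l => //; apply: leq_trans lts szn.
move/addIr; apply: mulrI; rewrite unitrV; exact: pi2_unit hg gg.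
Qed.

(** * Closure of polynomials with natural coefficients *)

Lemma natpoly2E (p : R) : natpoly2 p <-> forall i j, (p`_i)`_j \is a Num.nat.
Proof.
by split=> h i j; [have [m ->] := h i j | have /Num.Theory.natrP[m] := h i j; exists m].
Qed.

Lemma natpoly2D (p q : R) : natpoly2 p -> natpoly2 q -> natpoly2 (p + q).
Proof.
by move=> /natpoly2E hp /natpoly2E hq; apply/natpoly2E => i j; rewrite !coefD rpredD.
Qed.

Lemma natpoly2M (p q : R) : natpoly2 p -> natpoly2 q -> natpoly2 (p * q).
Proof.
move=> /natpoly2E hp /natpoly2E hq; apply/natpoly2E => i j.
rewrite coefM coef_sum; apply: rpred_sum => k _.
by rewrite coefM; apply: rpred_sum => l _; rewrite rpredM.
Qed.

Lemma natpoly2_nat m : natpoly2 m%:R.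
Proof.
apply/natpoly2E => i j; rewrite -polyC_natr coefC; case: eqP => _; last by rewrite coef0.
by rewrite -polyC_natr coefC; case: eqP => _; rewrite ?rpred_nat ?rpred0.
Qed.

Lemma natpoly2_yv : natpoly2 yv.
Proof.
apply/natpoly2E => i j; rewrite coefX -[in X in X \is a _]polyC_natr coefC.
by case: eqP => _; rewrite ?rpred_nat ?rpred0.
Qed.

Lemma natpoly2_zv : natpoly2 zv.
Proof.
apply/natpoly2E => i j; rewrite coefC; case: eqP => _; last by rewrite coef0 rpred0.
by rewrite coefX rpred_nat.
Qed.

Lemma natpoly2_orientations (T : eqType) (y z : R) (E : seq (T * T)) o :
  natpoly2 y -> natpoly2 z -> o \in orientations y z E -> natpoly2 o.1.
Proof.
move=> hy hz; elim: E o => [|p E IH] o /=.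
  by rewrite inE => /eqP -> /=; apply: (natpoly2_nat 1).
move=> /flattenP[s /mapP[o' /IH ho' ->]]; rewrite !inE.
by case/or3P => /eqP -> //=; apply: natpoly2M.
Qed.

Lemma natpoly2_peel (T : finType) (w : {set T} -> {set T} -> R) g f V :
  (forall V A, natpoly2 (w V A)) -> (forall V, natpoly2 (f V)) -> natpoly2 (peel w g f V).
Proof.
move=> hw hf; elim: g V => //= k g IH V.
apply: big_ind => [|p q|A _]; [exact: (natpoly2_nat 0) | exact: natpoly2D | exact: natpoly2M].
Qed.

Lemma natpoly2_omegaB_coef n (E : seq ('I_n * 'I_n)) a : natpoly2 (omegaB_coef E a).
Proof.
rewrite /omegaB_coef big_seq_cond; apply: big_ind => [|p q|o /andP[ho _]].
- exact: (natpoly2_nat 0).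
- exact: natpoly2D.
apply: natpoly2M; first exact: natpoly2_orientations natpoly2_yv natpoly2_zv ho.
by apply: natpoly2_peel => *; apply: natpoly2_nat.
Qed.

(** The F-coefficients [d] carry the linear map omega. The first half provides the expansions, so
    the second, about every such pair, is not vacuous. *)
Theorem theorem7p12 (n : nat) (E : seq ('I_n * 'I_n)) :
  (exists d c : seq nat -> R,
     (forall e : seq nat,
        Bcoef E (yv + 1) (zv + 1) e = \sum_(a <- comps n) d a * Fcoef n (setS a) e) /\
     (forall e : seq nat,
        \sum_(a <- comps n) d a * Fcoef n (omegaS n (setS a)) e =
        \sum_(a <- comps n) c a * Psicoef a e / (zcomp a)%:R)) /\
  (forall d c : seq nat -> R,
     (forall e : seq nat,
        Bcoef E (yv + 1) (zv + 1) e = \sum_(a <- comps n) d a * Fcoef n (setS a) e) ->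
     (forall e : seq nat,
        \sum_(a <- comps n) d a * Fcoef n (omegaS n (setS a)) e =
        \sum_(a <- comps n) c a * Psicoef a e / (zcomp a)%:R) ->
     forall a, a \in comps n -> natpoly2 (c a)).
Proof.
split=> [|d c hd hc a ha].
  have [d hd] := quasisymmetric_F_expansion (Bcoef_nonzeros E yv zv).
  exists d, (omegaB_coef E); split=> // e.
  rewrite (omega_coef _ hd) sum_Psicoef; case: ifP => // he; exact: sum_sgn_Bcoef.
suff -> : c a = omegaB_coef E a by apply: natpoly2_omegaB_coef.
apply: sum_refinements_inj ha => g hg; rewrite -(sum_sgn_Bcoef E hg).
(* Comparing coefficients at the exponent list [g] itself gives the triangular system. *)
by have := hc g; rewrite (omega_coef _ hd) sum_Psicoef (nonzeros_id hg) hg.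
Qed.
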